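(* Let $p\ge 1$ and let $U^p(\Gamma)$ be an $H^1$-conforming polynomial basis on the reference triangle $\Gamma$, split into vertex, edge and cell base functions $\mathcal V^p_i$, $\mathcal E^p_j$, $\mathcal C^p_{123}$. Let $$\mathcal T_1=\{\mathbf e_1,-\mathbf e_2\},\quad \mathcal T_2=\{\mathbf e_1-\mathbf e_2,-\mathbf e_2\},\quad \mathcal T_3=\{\mathbf e_1-\mathbf e_2,-\mathbf e_1\},$$ $$\mathcal T_{12}=\{\mathbf e_1,\mathbf e_2\},\quad \mathcal T_{13}=\{-\mathbf e_2,\mathbf e_1\},\quad \mathcal T_{23}=\{-\tfrac12(\mathbf e_1+\mathbf e_2),\mathbf e_2-\mathbf e_1\},\quad \mathcal T_{123}=\{\mathbf e_1,\mathbf e_2\}.$$ Then the element on the reference triangle with base functions $$\Big\{\bigoplus_{i=1}^3\mathcal V^p_i\otimes\mathcal T_i\Big\}\oplus\Big\{\bigoplus_{j\in\mathcal J}\mathcal E^p_j\otimes\mathcal T_j\Big\}\oplus\{\mathcal C^p_{123}\otimes\mathcal T_{123}\},\qquad \mathcal J=\{(1,2),(1,3),(2,3)\},$$ is $H(\mathrm{div})$-conforming under contravariant Piola transformations of the base functions.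
   Context: $\Gamma=\{(\xi,\eta)\in[0,1]^2 \mid \xi+\eta\le 1\}$ has vertices $v_1=(0,0)$, $v_2=(0,1)$, $v_3=(1,0)$, edges $e_{12},e_{13},e_{23}$ ($e_{ij}$ joins $v_i$ and $v_j$) and cell $c_{123}$. $\mathbf e_1,\mathbf e_2$ is the Cartesian basis. $P^p(\Gamma)$ denotes the polynomials of total degree at most $p$. $H^1$-conforming polynomial basis $U^p(\Gamma)$: linearly independent polynomials in $P^p(\Gamma)$ with $\dim U^p(\Gamma)=\dim P^p(\Gamma)=(p+2)(p+1)/2$, each associated with one polytope: one vertex base function for each vertex ($\mathcal V^p_i$), $p-1$ edge base functions for each edge ($\mathcal E^p_j$), $(p-2)(p-1)/2$ cell base functions ($\mathcal C^p_{123}$). A vertex base function vanishes at all other vertices and on the non-neighbouring edge; an edge base function vanishes on all other edges; a cell base function vanishes on the boundary. Being $H^1$-conforming means that, after mapping to the elements of a mesh by $n\mapsto n\circ\mathbf x_e^{-1}$ and identifying corresponding base functions of shared vertices and edges, the assembled functions are continuous across element interfaces. $\mathcal S\otimes\mathcal T_\ast$ denotes all products $n\boldsymbol\ell$ with $n\in\mathcal S$, $\boldsymbol\ell\in\mathcal T_\ast$. Association of the products $n\boldsymbol\ell$: to an edge $e_{ij}$ belong the products with $n\in\mathcal V^p_i,\ \boldsymbol\ell\in\mathcal T_i$, or $n\in\mathcal V^p_j,\ \boldsymbol\ell\in\mathcal T_j$, or $n\in\mathcal E^p_{ij},\ \boldsymbol\ell\in\mathcal T_{ij}$, where in each case $\boldsymbol\ell$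 has non-vanishing normal component on $e_{ij}$; to the cell belong the products with $n\in\mathcal E^p_{ij}$ and $\boldsymbol\ell\in\mathcal T_{ij}$ of vanishing normal component on $e_{ij}$, and those with $n\in\mathcal C^p_{123}$, $\boldsymbol\ell\in\mathcal T_{123}$. Meshes: $A\subset\mathbb R^2$ is decomposed into a conforming triangulation with elements $A_e=\mathbf x_e(\Gamma)$, with invertible element maps $\mathbf x_e$ (e.g. affine) with Jacobian matrix $\mathbf J_e$, chosen so that the local vertex order agrees on shared edges. The contravariant Piola transformation maps a reference field $\boldsymbol\phi$ to $\boldsymbol\varphi=\frac{1}{\det\mathbf J_e}\mathbf J_e\,\boldsymbol\phi\circ\mathbf x_e^{-1}$ (signed determinant). $H(\mathrm{div},A)=\{\mathbf u\in[L^2(A)]^2 \mid \mathrm{div}\,\mathbf u\in L^2(A)\}$. ''$H(\mathrm{div})$-conforming'' means: identifying corresponding mapped base functions of shared edges (and extending cell base functions by zero), the resulting piecewise space is a subspace of $H(\mathrm{div},A)$, equivalently the jump of the normal trace $\langle\mathbf n,\mathbf u\rangle$ vanishes on every element interface. *)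

(* Defs.v *)
From HB Require Import structures.
From mathcomp Require Import all_boot all_order all_algebra.
From mathcomp Require Import all_classical all_reals all_analysis.
From mathcomp Require Import -(notations) mpoly. (* notations clash *)
Set Implicit Arguments. Unset Strict Implicit. Unset Printing Implicit Defensive.
Import Order.TTheory GRing.Theory Num.Theory numFieldNormedType.Exports.
Local Open Scope classical_set_scope.
Local Open Scope ring_scope.

(* Points and vectors of the plane are row vectors 'rV[R]_2; x 0 0 is the xi
   coordinate and x 0 1 the eta coordinate.  Linear maps therefore act by
   right multiplication, and [jacobian] of the library is the transpose of
   the usual Jacobian matrix: J_e * phi reads [phi *m jacobian x_e xi]. *)

Notation poly2 R := (mpoly.mpoly 2 R). (* bivariate polynomials *)
Definition eval2 (R : realType) (n : poly2 R) (x : 'rV[R]_2) : R :=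
  meval (fun i => x 0 i) n.
Definition in_Pp (R : realType) (p : nat) (n : poly2 R) : Prop :=
  (mmeasure mdeg n <= p.+1)%N. (* [msize n] is degree + 1 *)

Definition dot (R : realType) (u v : 'rV[R]_2) : R := \sum_i u 0 i * v 0 i.
Definition rot90 (R : realType) (u : 'rV[R]_2) : 'rV[R]_2 :=
  \row_j (if j == 0 then - u 0 1 else u 0 0).
Definition e1 (R : realType) : 'rV[R]_2 := delta_mx 0 0.
Definition e2 (R : realType) : 'rV[R]_2 := delta_mx 0 1.
Arguments e1 {R}.
Arguments e2 {R}.

Definition Gamma (R : realType) : set 'rV[R]_2 :=
  [set x : 'rV[R]_2 | [/\ 0 <= x 0 0 <= 1, 0 <= x 0 1 <= 1 & x 0 0 + x 0 1 <= 1]].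
Arguments Gamma : clear implicits.

Inductive vertex := V1 | V2 | V3.
Inductive edge := E12 | E13 | E23.
Definition vertices := [:: V1; V2; V3].
Definition edges := [:: E12; E13; E23].

Definition vpt (R : realType) (i : vertex) : 'rV[R]_2 :=
  match i with V1 => 0 | V2 => e2 | V3 => e1 end.
Arguments vpt {R}.

(* e_ij joins v_i to v_j with i < j: [lo] is i, [hi] is j *)
Definition lo (s : edge) := match s with E12 => V1 | E13 => V1 | E23 => V2 end.
Definition hi (s : edge) := match s with E12 => V2 | E13 => V3 | E23 => V3 end.
Definition opposite (i : vertex) :=
  match i with V1 => E23 | V2 => E13 | V3 => E12 end.

Definition edge_pt (R : realType) (s : edge) (t : R) : 'rV[R]_2 :=
  (1 - t) *: vpt (lo s) + t *: vpt (hi s).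
Definition edge_set (R : realType) (s : edge) : set 'rV[R]_2 :=
  edge_pt s @` `[0, 1].
Definition tangent (R : realType) (s : edge) : 'rV[R]_2 :=
  vpt (hi s) - vpt (lo s).
Definition normal_comp (R : realType) (s : edge) (l : 'rV[R]_2) : R :=
  dot (rot90 (tangent R s)) l.

Section Mesh.
Variables (R : realType) (E : finType).
Implicit Types (M : E -> 'rV[R]_2 -> 'rV[R]_2).

(* M e is the element map x_e; only its values near Gamma matter. *)
Record conforming_mesh M : Prop := ConformingMesh {
  map_diff : forall e x, Gamma R x -> differentiable (M e) x ;
  map_C1 : forall e, {within Gamma R, continuous (jacobian (M e))} ;
  map_inj : forall e, {in Gamma R &, injective (M e)} ;
  map_det : forall e x, Gamma R x -> \det (jacobian (M e) x) != 0 ;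
  (* two elements meet in nothing, in a common vertex or in a common edge *)
  mesh_meet : forall e f, e != f ->
    let meet := M e @` Gamma R `&` M f @` Gamma R in
    [\/ meet = set0,
        exists i k, M e (vpt i) = M f (vpt k) /\ meet = [set M e (vpt i)]
      | exists s s', M e @` edge_set s = M f @` edge_set s' /\
                     meet = M e @` edge_set s] ;
  (* On a shared edge the two parametrizations, each running from the lower
     to the higher local vertex, coincide.  For affine maps this says exactly
     that the local vertex orders agree. *)
  mesh_match : forall e f s s',
    M e @` edge_set s = M f @` edge_set s' ->
    forall t, 0 <= t <= 1 -> M e (edge_pt s t) = M f (edge_pt s' t)
}.

Definition affine_mesh M : Prop :=
  forall e, exists (B : 'M[R]_2) (b : 'rV[R]_2), forall x, M e x = x *m B + b.

Definition domain M : set 'rV[R]_2 := (\bigcup_e (M e @` Gamma R))°.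

(* [interface M e s f s']: edge s of e and edge s' of f are the same edge *)
Definition interface M e s f s' : Prop :=
  e != f /\ M e @` edge_set s = M f @` edge_set s'.

Definition inv_map M e : 'rV[R]_2 -> 'rV[R]_2 :=
  'pinv_(fun=> 0) (Gamma R) (M e).

Definition pull M e (n : poly2 R) : 'rV[R]_2 -> R :=
  fun x => eval2 n (inv_map M e x).

Definition piola M e (phi : 'rV[R]_2 -> 'rV[R]_2) : 'rV[R]_2 -> 'rV[R]_2 :=
  fun x => let xi := inv_map M e x in
  let J := jacobian (M e) xi in (\det J)^-1 *: (phi xi *m J).

(* A piecewise field is a family w indexed by the elements, where w e matters
   on the element e only.  [assembled at loc] are the families obtained from
   local functions by identification: [at e l] says that the local polytope l
   of e is the global polytope under consideration, and then w e is a local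
   function in [loc e l]; w e is zero on the elements without such l. *)
Definition assembled (L : Type) (Y : zmodType) (at_ : E -> L -> Prop)
    (loc : E -> L -> set ('rV[R]_2 -> Y)) : set (E -> 'rV[R]_2 -> Y) :=
  [set w | forall e, (forall l, at_ e l -> loc e l (w e)) /\
                     ((forall l, ~ at_ e l) -> w e = fun=> 0)].

(* the function defined piecewise by w on the interiors of the elements; it is
   set to 0 on the skeleton, which is a null set *)
Definition piecewise M (w : E -> 'rV[R]_2 -> 'rV[R]_2) : 'rV[R]_2 -> 'rV[R]_2 :=
  fun x => \sum_(e : E) \1_((M e @` Gamma R)°) x *: w e x.

End Mesh.

Record h1_basis (R : realType) (p : nat) := H1Basis {
  vfun : vertex -> poly2 R ;
  efun : edge -> 'I_(p - 1) -> poly2 R ;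
  cfun : 'I_(((p - 2) * (p - 1)) %/ 2) -> poly2 R }.

Section H1.
Variables (R : realType) (p : nat) (U : h1_basis R p).

Record polynomial_basis : Prop := PolynomialBasis {
  vfun_deg : forall i, in_Pp p (vfun U i) ;
  efun_deg : forall s k, in_Pp p (efun U s k) ;
  cfun_deg : forall k, in_Pp p (cfun U k) ;
  basis_free : forall (a : vertex -> R) (b : edge -> 'I_(p - 1) -> R)
      (c : 'I_(((p - 2) * (p - 1)) %/ 2) -> R),
    \sum_(i <- vertices) a i *: vfun U i
      + \sum_(s <- edges) \sum_k b s k *: efun U s k
      + \sum_k c k *: cfun U k = 0 ->
    [/\ forall i, a i = 0, forall s k, b s k = 0 & forall k, c k = 0] ;
  vfun_vertex : forall i j, i <> j -> eval2 (vfun U i) (vpt j) = 0 ;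
  vfun_edge : forall i x, edge_set (opposite i) x -> eval2 (vfun U i) x = 0 ;
  efun_edge : forall s s' k x, s <> s' -> edge_set s' x ->
    eval2 (efun U s k) x = 0 ;
  cfun_edge : forall k s x, edge_set s x -> eval2 (cfun U k) x = 0 }.

(* Global vertices are points, global edges are sets of points. *)
Definition h1_assembled (E : finType) (M : E -> 'rV[R]_2 -> 'rV[R]_2) :
    set (E -> 'rV[R]_2 -> R) :=
  [set w |
    [\/ exists P, assembled (fun e i => M e (vpt i) = P)
          (fun e i => [set pull M e (vfun U i)]) w,
        exists S k, assembled (fun e s => M e @` edge_set s = S)
          (fun e s => [set pull M e (efun U s k)]) w
      | exists e0 k, assembled (fun e (_ : unit) => e = e0)
          (fun e _ => [set pull M e (cfun U k)]) w]].

Definition h1_conforming : Prop :=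
  forall (E : finType) (M : E -> 'rV[R]_2 -> 'rV[R]_2), conforming_mesh M ->
  forall w, h1_assembled M w ->
  forall e s f s', interface M e s f s' ->
  forall x, (M e @` edge_set s) x -> w e x = w f x.

End H1.

Section Hdiv.
Variable R : realType.

(* Lebesgue measure of the plane lives on R * R *)
Definition pt (z : R * R) : 'rV[R]_2 := \row_j (if j == 0 then z.1 else z.2).
Definition leb2 := (@lebesgue_measure R \x @lebesgue_measure R)%E.

Definition L2 (A : set 'rV[R]_2) (f : 'rV[R]_2 -> R) : Prop :=
  (f \o pt) \_ (pt @^-1` A) \in Lfun leb2 2%:E.

Definition int2 (A : set 'rV[R]_2) (f : 'rV[R]_2 -> R) : R :=
  \int[leb2]_(z in pt @^-1` A) f (pt z).

Fixpoint Ck (k : nat) (f : 'rV[R]_2 -> R) : Prop :=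
  if k is k'.+1
  then (forall x, differentiable f x) /\ (forall v, Ck k' ('D_v f))
  else continuous f.

Definition test_function (A : set 'rV[R]_2) (f : 'rV[R]_2 -> R) : Prop :=
  [/\ forall k, Ck k f, compact (closure [set x | f x != 0])
    & closure [set x | f x != 0] `<=` A].

(* g is the distributional divergence of u on the open set A *)
Definition weak_div (A : set 'rV[R]_2) (u : 'rV[R]_2 -> 'rV[R]_2)
    (g : 'rV[R]_2 -> R) : Prop :=
  forall f, test_function A f ->
    int2 A (fun x => \sum_(i < 2) u x 0 i * 'D_(delta_mx 0 i) f x) =
    - int2 A (fun x => g x * f x).

Definition Hdiv (A : set 'rV[R]_2) : set ('rV[R]_2 -> 'rV[R]_2) :=
  [set u : 'rV[R]_2 -> 'rV[R]_2 |
           (forall i : 'I_2, L2 A (fun x => u x 0 i)) /\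
           exists2 g, L2 A g & weak_div A u g].

End Hdiv.

Record template (R : realType) := Template {
  tv : vertex -> seq 'rV[R]_2 ;
  te : edge -> seq 'rV[R]_2 ;
  tc : seq 'rV[R]_2 }.

(* the base functions associated with an edge: those coming from its lower
   vertex, from its higher vertex, and from its edge functions *)
Inductive slot (p : nat) := Lower | Upper | Inner of 'I_(p - 1).
Arguments Lower {p}.
Arguments Upper {p}.

Section Element.
Variables (R : realType) (p : nat) (U : h1_basis R p) (T : template R).

Definition product (n : poly2 R) (l : 'rV[R]_2) : 'rV[R]_2 -> 'rV[R]_2 :=
  fun x => eval2 n x *: l.

Definition edge_products (s : edge) (c : slot p) :
    set ('rV[R]_2 -> 'rV[R]_2) :=
  match c with
  | Lower => [set product (vfun U (lo s)) l | l in
               [set l | l \in tv T (lo s) /\ normal_comp s l != 0]]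
  | Upper => [set product (vfun U (hi s)) l | l in
               [set l | l \in tv T (hi s) /\ normal_comp s l != 0]]
  | Inner k => [set product (efun U s k) l | l in
                 [set l | l \in te T s /\ normal_comp s l != 0]]
  end.

Definition cell_products : set ('rV[R]_2 -> 'rV[R]_2) :=
  [set phi | (exists s k l, [/\ l \in te T s, normal_comp s l = 0
                              & phi = product (efun U s k) l]) \/
             (exists k l, l \in tc T /\ phi = product (cfun U k) l)].

Section Global.
Variables (E : finType) (M : E -> 'rV[R]_2 -> 'rV[R]_2).

Definition hdiv_assembled : set (E -> 'rV[R]_2 -> 'rV[R]_2) :=
  [set w |
    (exists S c, assembled (fun e s => M e @` edge_set s = S)
       (fun e s => piola M e @` edge_products s c) w) \/
    (exists2 phi, cell_products phi & exists e0,
       assembled (fun e (_ : unit) => e = e0)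
         (fun e _ => [set piola M e phi]) w)].

Definition hdiv_space : set (E -> 'rV[R]_2 -> 'rV[R]_2) :=
  [set u | exists (m : nat) (a : 'I_m -> R)
             (w : 'I_m -> E -> 'rV[R]_2 -> 'rV[R]_2),
     (forall i, hdiv_assembled (w i)) /\
     forall e x, u e x = \sum_i a i *: w i e x].

(* [tangent s *m jacobian (M e) xi] is tangent to the curve [M e @` e_s] at
   [M e xi], and n runs over the vectors normal to it. *)
Definition no_normal_jump (u : E -> 'rV[R]_2 -> 'rV[R]_2) : Prop :=
  forall e s f s', interface M e s f s' ->
  forall xi, edge_set s xi ->
  forall n, dot n (tangent R s *m jacobian (M e) xi) = 0 ->
  dot n (u e (M e xi)) = dot n (u f (M e xi)).

End Global.

(* For arbitrary C1 element maps conformity is the absence of normal jumps; on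
   affine meshes the piecewise fields are moreover required to lie in H(div), with
   the divergence taken in the sense of distributions. *)
Definition hdiv_conforming : Prop :=
  forall (E : finType) (M : E -> 'rV[R]_2 -> 'rV[R]_2), conforming_mesh M ->
  forall u, hdiv_space M u ->
  no_normal_jump M u /\ (affine_mesh M -> Hdiv (domain M) (piecewise M u)).

End Element.

Definition hdiv_template (R : realType) : template R := {|
  tv i := match i with
          | V1 => [:: e1; - e2]
          | V2 => [:: e1 - e2; - e2]
          | V3 => [:: e1 - e2; - e1]
          end ;
  te s := match s with
          | E12 => [:: e1; e2]
          | E13 => [:: - e2; e1]
          | E23 => [:: - 2^-1 *: (e1 + e2); e2 - e1]
          end ;
  tc := [:: e1; e2] |}.

(* Main.v *)
Require Import Defs.
From HB Require Import structures.
From mathcomp Require Import all_boot all_order all_algebra.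
From mathcomp Require Import all_classical all_reals all_analysis.
From mathcomp Require Import measurable_realfun ring lra.
From mathcomp Require Import -(notations) mpoly.
Set Implicit Arguments. Unset Strict Implicit. Unset Printing Implicit Defensive.
Import Order.TTheory GRing.Theory Num.Theory numFieldNormedType.Exports.
Local Open Scope classical_set_scope.
Local Open Scope ring_scope.

(* If n is normal to tau J, then <n, phi J> / det J is a multiple of the flux
   <rot90 tau, phi> on the reference triangle, with a factor that depends only on
   n and on the image tau J of the tangent, hence is common to both sides of an
   interface.  All vectors of the template that cross an edge have flux -1 through
   it, so equality of the normal traces reduces to equality of the scalar traces,
   which is H1-conformity.

   On affine meshes the distributional divergence is computed element by element:
   a change of variables and the divergence theorem on the reference triangle turn
   the integral over an element into three edge terms
   sg(det J) * (sign of the edge) * int f <rot90 tau, phi>.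
   The two elements that share an edge lie on opposite sides of it, which forces
   opposite signs, so the terms cancel in pairs; on an unshared edge the test
   function vanishes, since such an edge is not in the interior of the mesh. *)

(** * Lebesgue measure of the plane *)

(** For an edge and one of its two vertices, exactly one vector in the list of that vertex crosses
    the edge, and this vector is parallel to the other edge at the vertex. Together with the
    vanishing of the scalar functions, this gives every edge base function a flux through one edge
    only. That flux does not depend on which admissible vector an element has picked, a choice that
    [edge_products] leaves open.

    Two facts needed for the cancellation are not axioms of [conforming_mesh] and are extracted from
    [mesh_meet]. Neighbours lie on opposite sides of their edge: otherwise points near its midpoint
    would belong to both elements without lying on the edge. An edge has at most two elements: three
    would yield three real numbers with pairwise negative products. Determinants keep their sign
    throughout, so the side of an element is read off from [\det (B e) * edge_sign R s] rather than
    from an orientation assumption.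

    [inv_map] is meaningful on its element only. For integration it is replaced by the affine
    inverse, which makes every integrand the restriction of a function continuous on the whole
    plane. *)

Section PlaneMeasure.
Variable R : realType.
Local Notation mR := (measurableTypeR R).
Local Notation mu := (@lebesgue_measure R).
Local Notation leb2 := (@leb2 R).

(** The sigma-algebra here is generated by products, so an open set has to be written as a countable
    union of rectangles: squares with rational centre and rational radius. *)
Lemma open_measurable2 (A : set (mR * mR)) :
  open (A : set (R * R)) -> measurable A.
Proof.
move=> oA.
pose B (q : rat * rat * rat) : set (mR * mR) :=
  ball (ratr q.1.1 : R) (ratr q.2) `*` ball (ratr q.1.2 : R) (ratr q.2).
have -> : A = \bigcup_(q in [set q | B q `<=` A]) B q.
  apply/seteqP; split => [z Az|z [q /= qA Bz]]; last exact: qA.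
  have /nbhs_ballP[e /= e0 eA] : nbhs (z : R * R) A by exact: open_nbhs_nbhs.
  have /rat_in_itvoo[r] : 0 < e / 2 by lra.
  rewrite in_itv/= => /andP[r0 re].
  have /rat_in_itvoo[a] : z.1 - ratr r < z.1 + ratr r by lra.
  have /rat_in_itvoo[b] : z.2 - ratr r < z.2 + ratr r by lra.
  rewrite !in_itv/= => /andP[b1 b2] /andP[a1 a2].
  exists (a, b, r) => /=; last first.
    by split; rewrite /ball/= ltr_distl; apply/andP; split; lra.
  move=> y [/= y1 y2]; apply: eA; split; rewrite /= /ball /= ltr_distl;
    move: y1 y2; rewrite /ball /= !ltr_distl => /andP[y1 y1'] /andP[y2 y2'];
    apply/andP; split; lra.
rewrite bigcup_mkcond; apply: countable_bigcupT_measurable => // q.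
by case: ifP => // _; apply: measurableX; rewrite ball_itv; exact: measurable_itv.
Qed.

Lemma continuous_measurable2 (h : R * R -> R) :
  continuous h -> measurable_fun [set: mR * mR] h.
Proof.
move=> /continuousP ch; apply: (measurability _ (RGenOpens.measurableE R)).
move=> _ [_ [a [b ->] <-]]; rewrite setTI; apply: open_measurable2.
exact/ch/interval_open.
Qed.

Lemma lebesgue_measure_affine (c d : R) (A : set mR) : c != 0 -> measurable A ->
  mu ((fun y => c * y + d) @^-1` A) = (`|c|^-1%:E * mu A)%E.
Proof.
move=> c0 mA.
have mf : measurable_fun [set: mR] ((fun y => c * y + d) : mR -> mR).
  apply: continuous_measurable_fun => x.
  by apply: cvgD; [apply: cvgMr; exact: cvg_id|exact: cvg_cst].
suff -> : mu A = (`|c|%:E * mu ((fun y : R => (c * y + d)%R) @^-1` A))%E.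
  by rewrite muleA -EFinM mulVf ?mul1e// normr_eq0.
(* Lebesgue measure is determined by its values on half-open intervals, so it suffices to compare it
   there with the rescaled pushforward. For [c < 0] the preimage has its closed end on the other
   side, hence the two cases. *)
pose nu := mscale (NngNum (normr_ge0 c)) (pushforward mu ((fun y => c * y + d) : mR -> mR)).
suff : forall X, ocitv X -> mu X = nu mf X.
  by move=> /(@lebesgue_measure_unique R (nu mf))/(_ A mA).
move=> _ [[a b]] _ <-.
rewrite /= /nu /mscale/= /pushforward.
have [cp|cn|cz] := ltgtP c 0; last by rewrite cz eqxx in c0.
- have -> : (fun y => c * y + d) @^-1` `]a, b] = `[((b - d) / c), ((a - d) / c)[%classic.
    apply/seteqP; split => y /=; rewrite !in_itv/= => /andP[h1 h2]; apply/andP; split.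
    + by rewrite ler_ndivrMr//; lra.
    + by rewrite ltr_ndivlMr//; lra.
    + by move: h2; rewrite ltr_ndivlMr//; lra.
    + by move: h1; rewrite ler_ndivrMr//; lra.
  rewrite !lebesgue_measure_itv/= !lte_fin.
  have -> : ((b - d) / c < (a - d) / c) = (a < b).
    by rewrite ltr_nM2r ?invr_lt0//; apply/idP/idP; lra.
  case: ifP => _; last by rewrite mule0.
  by rewrite -EFinM ltr0_norm//; congr EFin; field.
- have -> : (fun y => c * y + d) @^-1` `]a, b] = `]((a - d) / c), ((b - d) / c)]%classic.
    apply/seteqP; split => y /=; rewrite !in_itv/= => /andP[h1 h2]; apply/andP; split.
    + by rewrite ltr_pdivrMr//; lra.
    + by rewrite ler_pdivlMr//; lra.
    + by move: h1; rewrite ltr_pdivrMr//; lra.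
    + by move: h2; rewrite ler_pdivlMr//; lra.
  rewrite !lebesgue_measure_itv/= !lte_fin.
  have -> : ((a - d) / c < (b - d) / c) = (a < b).
    by rewrite ltr_pM2r ?invr_gt0//; apply/idP/idP; lra.
  case: ifP => _; last by rewrite mule0.
  by rewrite -EFinM gtr0_norm//; congr EFin; field.
Qed.

(** [k] stands for the absolute value of the Jacobian determinant. Preimages are used because they
    compose well and express a statement about the pushforward measure. *)
Definition scales (phi : mR * mR -> mR * mR) (k : R) : Prop :=
  measurable_fun setT phi /\
  forall A, measurable A -> leb2 (phi @^-1` A) = (k^-1%:E * leb2 A)%E.

Lemma scales_comp phi psi k l : scales phi k -> scales psi l ->
  scales (phi \o psi) (k * l).
Proof.
move=> [mphi sphi] [mpsi spsi]; split; first exact: measurableT_comp.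
move=> A mA; rewrite comp_preimage spsi; last first.
  by rewrite -[X in measurable X]setTI; exact: mphi.
by rewrite sphi// muleA -EFinM invfM mulrC.
Qed.

Lemma scales_swap : scales (fun z => (z.2, z.1)) 1.
Proof.
have ms : measurable_fun [set: mR * mR] (fun z : mR * mR => (z.2, z.1) : mR * mR).
  by apply: measurable_fun_pair.
split=> // A mA; rewrite invr1 mul1e.
rewrite [RHS](@product_measure_unique _ _ _ _ _ mu mu
  (pushforward leb2 (fun z : mR * mR => (z.2, z.1) : mR * mR)))//.
move=> B C mB mC; rewrite /pushforward.
transitivity (leb2 (C `*` B)); last by rewrite /Defs.leb2 product_measure1E// muleC.
by congr (leb2 _); apply/seteqP; split => -[x y] [].
Qed.

(** Cavalieri: on each vertical section the map is a one-dimensional affine map with slope [c], and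
    only its offset depends on the section. *)
Lemma scales_shear (c d e : R) : c != 0 ->
  scales (fun z => (z.1, c * z.2 + d * z.1 + e)) `|c|.
Proof.
move=> c0; split.
  apply: measurable_fun_pair => //=.
  apply: measurable_funD => //; apply: measurable_funD => //; exact: measurable_funM.
move=> A mA.
rewrite /Defs.leb2 /product_measure1/=.
rewrite -ge0_integralZl//=.
- apply: eq_integral => x _ /=.
  rewrite -(@lebesgue_measure_affine c (d * x + e))//; last exact: measurable_xsection.
  congr (mu _); apply/seteqP; split => y; rewrite /xsection/= !inE/=.
    by rewrite -addrA; exact.
  by rewrite addrA; exact.
- exact: measurable_fun_xsection.
Qed.

Lemma scales_affine (a b c d e f : R) : a * d - b * c != 0 ->
  scales (fun z => (a * z.1 + b * z.2 + e, c * z.1 + d * z.2 + f))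
         `|a * d - b * c|.
Proof.
have main a' b' c' d' e' f' : d' != 0 -> a' * d' - b' * c' != 0 ->
    scales (fun z => (a' * z.1 + b' * z.2 + e', c' * z.1 + d' * z.2 + f'))
           `|a' * d' - b' * c'|.
  move=> d0 D0.
  (* Gaussian elimination: the second output [v] is formed first. Substituting
     [z.2 = (v - c' * z.1 - f') / d'] in the first output gives the coefficients of the other
     shear. *)
  have := scales_comp scales_swap (scales_comp (@scales_shear (a' - b' * c' / d')
    (b' / d') (e' - b' / d' * f') _) (scales_comp scales_swap (@scales_shear d' c' f' d0))).
  rewrite !mul1r -normrM.
  have -> : (a' - b' * c' / d') * d' = a' * d' - b' * c' by field.
  move=> H; suff <- : (fun z : mR * mR => (z.2, z.1)) \o ((fun z : mR * mR =>
      (z.1, (a' - b' * c' / d') * z.2 + b' / d' * z.1 + (e' - b' / d' * f'))) \o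
     ((fun z : mR * mR => (z.2, z.1)) \o (fun z : mR * mR => (z.1, d' * z.2 + c' * z.1 + f')))) =
     (fun z : mR * mR => (a' * z.1 + b' * z.2 + e', c' * z.1 + d' * z.2 + f')).
    apply: H; apply: contra D0 => /eqP h; apply/eqP.
    have -> : a' * d' - b' * c' = (a' - b' * c' / d') * d' by field.
    by rewrite h mul0r.
  by apply/funext => -[x y] /=; congr pair; field.
move=> D0; have [d0|d0] := eqVneq d 0; last exact: main.
(* With a zero pivot, the two input coordinates are exchanged and [c] becomes the pivot. *)
have c0 : c != 0 by apply: contraNneq D0 => ->; rewrite d0 !mulr0 subr0.
have D1 : b * c - a * d != 0 by rewrite -oppr_eq0 opprB.
have := scales_comp (@main b a d c e f c0 D1) scales_swap.
rewrite mulr1 distrC; congr (scales _ _).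
by apply/funext => -[x y] /=; congr pair; rewrite (addrC (_ * y)).
Qed.

Lemma integral_scales phi k (D : set (mR * mR)) (f : mR * mR -> \bar R) :
  0 < k -> scales phi k -> measurable D -> measurable_fun setT f ->
  leb2.-integrable (phi @^-1` D) (f \o phi) ->
  (\int[leb2]_(z in D) f z = k%:E * \int[leb2]_(z in phi @^-1` D) (f \o phi) z)%E.
Proof.
move=> k0 [mphi sphi] mD mf intf.
pose nu := mscale (NngNum (ltW k0)) (pushforward leb2 phi).
rewrite (@eq_measure_integral _ _ _ _ (nu mphi)); last first.
  move=> A mA _; transitivity (k%:E * leb2 (phi @^-1` A))%E => //.
  by rewrite sphi// muleA -EFinM mulfV ?mul1e// gt_eqF.
rewrite -(integral_pushforward mphi mf intf mD).
have mfD : measurable_fun D f by exact: measurable_funTS.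
(* The factor is pulled out of the positive and the negative part separately. Integrability keeps
   the difference of the two well defined. *)
rewrite integralE [in RHS]integralE !ge0_integral_mscale//=; last first.
- exact: measurable_funepos.
- exact: measurable_funeneg.
have ifp := integrable_pushforward mphi mf intf mD.
rewrite [RHS]muleBr//; apply: fin_num_adde_defl.
by rewrite fin_numN; exact: integrable_neg_fin_num.
Qed.

Lemma pt_continuous : continuous (@pt R).
Proof.
move=> z; apply/cvg_ballP => e e0.
apply: filterS (@nbhsx_ballx R (R * R)%type z e e0) => y zy.
rewrite /ball /= /mx_ball; split=> // i j.
by move: zy; rewrite /pt !mxE; case: ifP => _ [].
Qed.

Lemma row2P (u v : 'rV[R]_2) : u 0 0 = v 0 0 -> u 0 1 = v 0 1 -> u = v.
Proof.
move=> h0 h1; apply/rowP => -[[|[|//]] Hi].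
- by rewrite (_ : Ordinal Hi = 0) //; exact/val_inj.
- by rewrite (_ : Ordinal Hi = 1) //; exact/val_inj.
Qed.

Lemma sum2E (f : 'I_2 -> R) : \sum_i f i = f 0 + f 1.
Proof.
rewrite big_ord_recl big_ord1; congr (_ + f _); exact/val_inj.
Qed.

Lemma det2E (B : 'M[R]_2) : \det B = B 0 0 * B 1 1 - B 0 1 * B 1 0.
Proof.
rewrite (expand_det_row _ 0) sum2E /cofactor !det_mx11 !mxE /=.
rewrite (_ : lift 0 0 = 1); last exact/val_inj.
rewrite (_ : lift 1 0 = 0); last exact/val_inj.
by rewrite !expr0 !expr1 mul1r mulN1r mulrN.
Qed.

Lemma measurable_pt_open (A : set 'rV[R]_2) : open A ->
  measurable (@pt R @^-1` A : set (mR * mR)).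
Proof.
move=> oA; apply: open_measurable2; apply: open_comp => // z _.
exact: pt_continuous.
Qed.

Lemma measurable_pt (f : 'rV[R]_2 -> R) : continuous f ->
  measurable_fun [set: mR * mR] (f \o @pt R).
Proof.
move=> cf; apply: continuous_measurable2 => z.
by apply: continuous_comp; [exact: pt_continuous|exact: cf].
Qed.

Lemma leb2_bounded (D : set 'rV[R]_2) (N : R) : measurable (@pt R @^-1` D : set (mR * mR)) ->
  (forall x, D x -> `|x 0 0| <= N /\ `|x 0 1| <= N) ->
  (leb2 (@pt R @^-1` D) < +oo)%E.
Proof.
move=> mD DN; apply: (@le_lt_trans _ _ (leb2 (`[-N, N] `*` `[-N, N]))).
  apply: le_measure; rewrite ?inE//.
    exact: measurableX.
  move=> [x y] /= /DN; rewrite !mxE/= => -[h1 h2].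
  by split; rewrite /= in_itv/= -ler_norml.
rewrite /Defs.leb2 product_measure1E//= lebesgue_measure_itv/=.
by case: ifP => _; rewrite ?mule0// ?mul0e// -EFinM ltry.
Qed.

Lemma bounded_integrable (D : set 'rV[R]_2) (f : 'rV[R]_2 -> R) (N C : R) :
  measurable (@pt R @^-1` D : set (mR * mR)) ->
  measurable_fun [set: mR * mR] (f \o @pt R) ->
  (forall x, D x -> `|x 0 0| <= N /\ `|x 0 1| <= N) ->
  (forall x, D x -> `|f x| <= C) ->
  leb2.-integrable (@pt R @^-1` D) (EFin \o (f \o @pt R)).
Proof.
move=> mD mf DN DC; apply: measurable_bounded_integrable => //.
- exact: leb2_bounded DN.
- exact: measurable_funTS.
- exists C; split; first exact: num_real.
  by move=> x Cx z Dz /=; rewrite (le_trans (DC _ Dz))// ltW.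
Qed.

Lemma int2_affine (B : 'M[R]_2) (b : 'rV[R]_2) (D : set 'rV[R]_2) (f : 'rV[R]_2 -> R) :
  let M := fun x => x *m B + b in \det B != 0 ->
  measurable (@pt R @^-1` D : set (mR * mR)) ->
  measurable_fun [set: mR * mR] (f \o @pt R) ->
  leb2.-integrable (@pt R @^-1` (M @^-1` D)) (EFin \o (f \o M \o @pt R)) ->
  int2 D f = `|\det B| * int2 (M @^-1` D) (f \o M).
Proof.
move=> M B0 mD mf intf.
(* Points are row vectors, so the coefficients of each output coordinate form a column of [B]. *)
pose phi (z : mR * mR) : mR * mR := (B 0 0 * z.1 + B 1 0 * z.2 + b 0 0,
   B 0 1 * z.1 + B 1 1 * z.2 + b 0 1).
have ptphi z : pt (phi z) = M (pt z).
  by apply: row2P; rewrite /M !mxE !sum2E !mxE /=; ring.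
have detE : \det B = B 0 0 * B 1 1 - B 1 0 * B 0 1 by rewrite det2E (mulrC (B 0 1)).
have sphi : scales phi `|\det B|.
  by rewrite detE; apply: scales_affine; rewrite -detE.
have phiD : phi @^-1` (@pt R @^-1` D) = @pt R @^-1` (M @^-1` D).
  by apply/seteqP; split => z /=; rewrite ptphi.
have fphi : (EFin \o (f \o @pt R)) \o phi = EFin \o (f \o M \o @pt R).
  by apply/funext => z /=; rewrite ptphi.
rewrite /int2 /Rintegral (integral_scales _ sphi mD); last 3 first.
- by rewrite normr_gt0.
- exact/measurable_EFinP.
- by rewrite phiD fphi.
rewrite phiD fphi.
rewrite fineM//; apply: integrable_fin_num => //.
by rewrite -phiD -[X in measurable X]setTI; exact: (proj1 sphi).
Qed.

End PlaneMeasure.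

(** * Continuously differentiable functions *)

Section C1Functions.
Variable R : realType.
Local Notation V := 'rV[R]_2.
Implicit Types f g : V -> R.

Lemma continuous_add f g : continuous f -> continuous g ->
  continuous (fun x => f x + g x).
Proof. by move=> cf cg x; exact: (continuousD (cf x) (cg x)). Qed.

Lemma continuous_mul f g : continuous f -> continuous g ->
  continuous (fun x => f x * g x).
Proof. by move=> cf cg x; exact: (continuousM (cf x) (cg x)). Qed.

Lemma C1_continuous f : Ck 1 f -> continuous f.
Proof. by move=> [df _] x; exact: differentiable_continuous. Qed.

Lemma C1_cst c : Ck 1 (fun=> c : R).
Proof.
split=> [x|v]; first exact: differentiable_cst.
rewrite (_ : 'D_v _ = fun=> 0); first exact: cst_continuous.
by apply/funext => x; rewrite derive_cst.
Qed.

Lemma C1D f g : Ck 1 f -> Ck 1 g -> Ck 1 (fun x => f x + g x).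
Proof.
move=> [df cf] [dg cg]; split=> [x|v]; first exact: differentiableD.
rewrite (_ : 'D_v _ = fun x => 'D_v f x + 'D_v g x).
  exact: continuous_add.
by apply/funext => x; rewrite deriveD//; exact: diff_derivable.
Qed.

Lemma C1M f g : Ck 1 f -> Ck 1 g -> Ck 1 (fun x => f x * g x).
Proof.
move=> Cf Cg; have [[df cf] [dg cg]] := (Cf, Cg).
split=> [x|v]; first exact: differentiableM.
rewrite (_ : 'D_v _ = fun x => f x *: 'D_v g x + g x *: 'D_v f x).
  by apply: continuous_add; apply: continuous_mul => //; exact: C1_continuous.
by apply/funext => x; rewrite deriveM//; exact: diff_derivable.
Qed.

Lemma C1X f n : Ck 1 f -> Ck 1 (fun x => f x ^+ n).
Proof.
move=> Cf; elim: n => [|n IH]; first by under eq_fun do rewrite expr0; exact: C1_cst.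
by under eq_fun do rewrite exprS; exact: C1M.
Qed.

Lemma C1_sum (I : Type) (r : seq I) (F : I -> V -> R) :
  (forall i, Ck 1 (F i)) -> Ck 1 (fun x => \sum_(i <- r) F i x).
Proof.
move=> CF; elim: r => [|i r IH].
  by under eq_fun do rewrite big_nil; exact: C1_cst.
by under eq_fun do rewrite big_cons; exact: C1D.
Qed.

Lemma C1_coord i : Ck 1 (fun x : V => x 0 i).
Proof.
have lin : linear (fun x : V => x 0 i : R) by move=> a u v; rewrite !mxE.
pose L := GRing.isLinear.Build R V R _ _ lin.
pose h : {linear V -> R} := HB.pack (fun x : V => x 0 i : R) L.
have hc : continuous h by exact: coord_continuous.
have hd x : differentiable h x by exact: linear_differentiable.
split=> [x|v]; first exact: hd.
rewrite (_ : 'D_v _ = fun=> v 0 i); first exact: cst_continuous.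
by apply/funext => x; rewrite (deriveE _ (hd x)) diff_lin.
Qed.

Lemma C1_eval2 (p : poly2 R) : Ck 1 (eval2 p).
Proof.
rewrite /eval2; under eq_fun do rewrite mevalE.
apply: C1_sum => m; apply: C1M; first exact: C1_cst.
under eq_fun do rewrite big_ord_recl big_ord1.
by apply: C1M; apply: C1X; exact: C1_coord.
Qed.

(** Both sides are limits of the same difference quotient: moving [y] along [v] moves its image
    along [v *m B]. *)
Lemma derive_affine (W : normedModType R) (f : V -> W) (B : 'M[R]_2) (b : V) x v :
  'D_v (fun y => f (y *m B + b)) x = 'D_(v *m B) f (x *m B + b).
Proof.
rewrite /derive /=; under eq_fun do rewrite mulmxDl -scalemxAl -addrA.
by [].
Qed.

Lemma affine_differentiable (B : 'M[R]_2) (b x : V) :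
  differentiable (fun x : V => x *m B + b) x.
Proof.
apply: (@differentiableD _ _ _ (mulmxr B : V -> V)); last exact: differentiable_cst.
have C1_entry (i j : 'I_2) : Ck 1 (fun y : V => y 0 i * B i j).
  by apply: C1M; [exact: C1_coord|exact: C1_cst].
rewrite (_ : (mulmxr B : V -> V) = fun y => (\sum_i y 0 i * B i 0) *: delta_mx 0 0 +
   (\sum_i y 0 i * B i 1) *: delta_mx 0 1).
  by apply: differentiableD; apply: differentiableZl; apply: (proj1 (C1_sum _ _)).
by apply/funext => y; apply: row2P; rewrite !mxE /= ?mulr1 ?mulr0 ?addr0 ?add0r.
Qed.

Lemma affine_continuous (B : 'M[R]_2) (b : V) : continuous (fun x : V => x *m B + b).
Proof. by move=> x; apply: differentiable_continuous; exact: affine_differentiable. Qed.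

Lemma C1_affine f (B : 'M[R]_2) (b : V) : Ck 1 f -> Ck 1 (fun x => f (x *m B + b)).
Proof.
move=> [df cf]; split=> [x|v].
  exact: (differentiable_comp (affine_differentiable B b x) (df _)).
rewrite (_ : 'D_v _ = fun x => 'D_(v *m B) f (x *m B + b)).
  move=> x; exact: (@continuous_comp V V R (fun y => y *m B + b)
    ('D_(v *m B) f) x (@affine_continuous B b x) (cf (v *m B) _)).
by apply/funext => x; exact: derive_affine.
Qed.

End C1Functions.

(** * Integration over the reference triangle by slices *)

Section ReferenceDivergence.
Variable R : realType.
Local Notation V := 'rV[R]_2.
Local Notation mR := (measurableTypeR R).
Local Notation mu := (@lebesgue_measure R).
Local Notation pt := (@pt R).

Definition open_Gamma : set V :=
  [set x : V | [/\ 0 < x 0 0, 0 < x 0 1 & x 0 0 + x 0 1 < 1]].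

Lemma open_open_Gamma : open open_Gamma.
Proof.
have c0 : continuous (fun x : V => x 0 0 : R) by exact: coord_continuous.
have c1 : continuous (fun x : V => x 0 1 : R) by exact: coord_continuous.
have -> : open_Gamma = (fun x : V => x 0 0) @^-1` [set t | 0 < t] `&`
   ((fun x : V => x 0 1) @^-1` [set t | 0 < t] `&`
    (fun x : V => x 0 0 + x 0 1) @^-1` [set t | t < 1]).
  by apply/seteqP; split => x /=; [case|case=> ? []].
apply: openI; first by apply: open_comp; [move=> ? _; exact: c0|exact: open_gt].
apply: openI; first by apply: open_comp; [move=> ? _; exact: c1|exact: open_gt].
apply: open_comp; last exact: open_lt.
by move=> ? _; exact: continuous_add.
Qed.

(** The fundamental theorem of calculus on a slice; the two end points are null sets. The case
    [a <= 0] serves the lines that miss the triangle. *)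
Lemma integral_slice (k K : R -> R) (a : R) : continuous k ->
  (forall x : R, is_derive x 1 K (k x)) ->
  (\int[mu]_x ((k \_ `]0, a[) x)%:E = if (0 < a)%R then (K a - K 0)%:E else 0)%E.
Proof.
move=> ck dK.
transitivity (\int[mu]_(x in `]0%R, a[) (k x)%:E)%E.
  by rewrite [RHS]integral_mkcond; apply: eq_integral => x _; rewrite !patchE; case: ifP.
case: ifPn => a0; last first.
  by rewrite set_itv_ge ?integral_set0// bnd_simp.
have mk (D : set mR) : measurable_fun D (EFin \o k).
  by apply/measurable_EFinP; apply: measurable_funTS; exact: continuous_measurable_fun.
rewrite (@integral_itv_bndo_bndc R (BRight 0) a (EFin \o k)); last exact: mk.
rewrite (@integral_itv_obnd_cbnd R 0 (BRight a) (EFin \o k)); last exact: mk.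
rewrite (@continuous_FTC2 _ k K)//.
- by move=> x; exact: continuous_subspaceT.
- have cK : continuous K.
    by move=> x; apply: differentiable_continuous; apply/derivable1_diffP; case: (dK x).
  by split => [x _||]; [case: (dK x)|exact: cvg_at_right_filter (cK _)|exact: cvg_at_left_filter (cK _)].
- by move=> x _; rewrite derive1E; case: (dK x).
Qed.

Lemma derive_line (W : normedModType R) (G : V -> W) (p v : V) (x : R) :
  differentiable G (p + x *: v) ->
  is_derive x 1 (fun t : R => G (p + t *: v)) ('D_v G (p + x *: v)).
Proof.
move=> dG; have /diff_derivable H := dG.
have E h : G (p + (h *: (1 : R) + x) *: v) = G (h *: v + (p + x *: v)).
  by rewrite [h *: _]mulr1 scalerDl addrCA.
have := H v; rewrite /derivable /= => {}H.
by split; rewrite /derivable /derive /=; under eq_fun do rewrite E.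
Qed.

Lemma pt_line1 (x y : R) : pt (x, y) = pt (0, y) + x *: delta_mx 0 0.
Proof. by apply: row2P; rewrite !mxE /=; ring. Qed.

Lemma pt_line2 (x y : R) : pt (x, y) = pt (x, 0) + y *: delta_mx 0 1.
Proof. by apply: row2P; rewrite !mxE /=; ring. Qed.

Lemma Gamma_bounded (x : V) : Gamma R x -> `|x 0 0| <= 1 /\ `|x 0 1| <= 1.
Proof. by move=> [/andP[? ?] /andP[? ?] _]; split; rewrite ger0_norm. Qed.

Lemma open_Gamma_sub : open_Gamma `<=` Gamma R.
Proof. by move=> x [h1 h2 h3]; split; try apply/andP; try split; lra. Qed.

Lemma compact_Gamma : compact (Gamma R).
Proof.
apply: bounded_closed_compact.
  exists 1; split; first exact: num_real.
  move=> N N1 x /Gamma_bounded [h1 h2]; rewrite /= (le_trans _ (ltW N1))//.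
  rewrite [`|x|]mx_normrE; apply: bigmax_le => // -[i j] _ /=.
  rewrite (ord1 i); case: j => -[|[|//]] Hj.
  - by rewrite (_ : Ordinal Hj = 0)//; exact/val_inj.
  - by rewrite (_ : Ordinal Hj = 1)//; exact/val_inj.
have c0 : continuous (fun x : V => x 0 0 : R) by exact: coord_continuous.
have c1 : continuous (fun x : V => x 0 1 : R) by exact: coord_continuous.
have -> : Gamma R = (fun x : V => x 0 0) @^-1` [set t | 0 <= t] `&`
   ((fun x : V => x 0 1) @^-1` [set t | 0 <= t] `&`
    (fun x : V => x 0 0 + x 0 1) @^-1` [set t | t <= 1]).
  apply/seteqP; split => x /=; first by case=> /andP[? ?] /andP[? ?] ?.
  by case=> h1 [h2 h3]; split; try apply/andP; try split; lra.
apply: closedI; first by apply: closed_comp; [move=> ? _; exact: c0|exact: closed_ge].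
apply: closedI; first by apply: closed_comp; [move=> ? _; exact: c1|exact: closed_ge].
apply: closed_comp; last exact: closed_le.
by move=> ? _; exact: continuous_add.
Qed.

Lemma continuous_compact_bounded (K : set V) (f : V -> R) : compact K -> continuous f ->
  exists C, forall x, K x -> `|f x| <= C.
Proof.
move=> cK cf.
have /compact_bounded[M [_ HM]] : compact (f @` K).
  by apply: continuous_compact => //; exact: continuous_subspaceT.
by exists (M + 1) => x Kx; apply: (HM (M + 1)); [rewrite ltrDl|exists x].
Qed.

Lemma continuous_integrable_open_Gamma (f : V -> R) : continuous f ->
  (@leb2 R).-integrable (pt @^-1` open_Gamma) (EFin \o (f \o pt)).
Proof.
move=> cf; have [C HC] := continuous_compact_bounded compact_Gamma cf.
apply: (@bounded_integrable _ _ _ 1 C).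
- exact: measurable_pt_open open_open_Gamma.
- exact: measurable_pt.
- by move=> x /open_Gamma_sub/Gamma_bounded.
- by move=> x /open_Gamma_sub/HC.
Qed.

Lemma integrable_open_Gamma_patch (g : V -> R) : continuous g ->
  (@leb2 R).-integrable setT ((EFin \o (g \o pt)) \_ (pt @^-1` open_Gamma)).
Proof.
move=> cg; have mO := measurable_pt_open open_open_Gamma.
by apply/(integrable_mkcond _ mO); exact: continuous_integrable_open_Gamma.
Qed.

Lemma continuous_line (g : V -> R) (p v : V) : continuous g ->
  continuous (fun t : R => g (p + t *: v)).
Proof.
move=> cg t; apply: (@continuous_comp _ _ _ (fun t : R => p + t *: v) g); last exact: cg.
apply: differentiable_continuous; apply: differentiableD; first exact: differentiable_cst.
by apply: (@differentiableZl _ _ _ (id : R -> R)).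
Qed.

Lemma continuous_pt1 (g : V -> R) (y : R) : continuous g ->
  continuous (fun x : R => g (pt (x, y))).
Proof. by move=> cg; under eq_fun do rewrite pt_line1; exact: continuous_line. Qed.

Lemma continuous_pt2 (g : V -> R) (x : R) : continuous g ->
  continuous (fun y : R => g (pt (x, y))).
Proof. by move=> cg; under eq_fun do rewrite pt_line2; exact: continuous_line. Qed.

Lemma mem_oo (y a b : R) : (y \in (`]a, b[%classic : set mR)) = (a < y < b).
Proof. by apply/idP/idP; rewrite inE/= in_itv. Qed.

(** By Fubini, each slice parallel to the xi axis contributes the difference of [G] at its two ends,
    one on e_23 and one on e_12. *)
Lemma int2_open_Gamma1 (G : V -> R) : Ck 1 G ->
  (\int[@leb2 R]_(z in pt @^-1` open_Gamma) ('D_(delta_mx 0 0) G (pt z))%:E =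
  \int[mu]_(t in `]0%R, 1%R[) (G (pt (1 - t, t)) - G (pt (0, t)))%:E)%E.
Proof.
move=> CG; have cD := (proj2 CG (delta_mx 0 0)) : continuous _.
have ig := integrable_open_Gamma_patch cD.
rewrite [LHS]integral_mkcond -(integral21_prod_meas1 ig).
rewrite /fubini_G [RHS]integral_mkcond; apply: eq_integral => y _.
rewrite [RHS]patchE.
transitivity (\int[mu]_x (((fun x => 'D_(delta_mx 0 0) G (pt (x, y))) \_
   (if (0 < y)%R then `]0%R, (1 - y)%R[%classic else set0)) x)%:E)%E.
  apply: eq_integral => x _; rewrite !patchE.
  have -> : ((x, y) \in pt @^-1` open_Gamma) =
     (x \in (if 0 < y then `]0, 1 - y[%classic else set0 : set R)).
    apply/idP/idP; rewrite !inE /= /open_Gamma/= !mxE/=; case: ifP => // y0.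
    - by case=> x0 _ xy; rewrite /= in_itv/= x0/=; lra.
    - by case.
    - by rewrite /= in_itv/= => /andP[x0 xy]; split => //; lra.
  by case: ifP.
case: ifPn => y0; last first.
  rewrite mem_oo (negbTE y0)/=.
  by transitivity (0%E : \bar R) => //; apply: integral0_eq => x _; rewrite patchE in_set0.
have dG (x : R) : is_derive x 1 (fun x => G (pt (x, y))) ('D_(delta_mx 0 0) G (pt (x, y))).
  rewrite (_ : (fun x => G (pt (x, y))) = fun t => G (pt (0, y) + t *: delta_mx 0 0)).
    by rewrite (pt_line1 x); exact/derive_line/(proj1 CG).
  by apply/funext => t; rewrite (pt_line1 t).
rewrite (integral_slice _ _ dG).
- by rewrite subr_gt0 mem_oo y0.
- exact: (@continuous_pt1 ('D_(delta_mx 0 0) G) y cD).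
Qed.

Lemma int2_open_Gamma2 (G : V -> R) : Ck 1 G ->
  (\int[@leb2 R]_(z in pt @^-1` open_Gamma) ('D_(delta_mx 0 1) G (pt z))%:E =
  \int[mu]_(t in `]0%R, 1%R[) (G (pt (t, 1 - t)) - G (pt (t, 0)))%:E)%E.
Proof.
move=> CG; have cD := (proj2 CG (delta_mx 0 1)) : continuous _.
have ig := integrable_open_Gamma_patch cD.
rewrite [LHS]integral_mkcond -(integral12_prod_meas1 ig).
rewrite /fubini_F [RHS]integral_mkcond; apply: eq_integral => x _.
rewrite [RHS]patchE.
transitivity (\int[mu]_y (((fun y => 'D_(delta_mx 0 1) G (pt (x, y))) \_
   (if (0 < x)%R then `]0%R, (1 - x)%R[%classic else set0)) y)%:E)%E.
  apply: eq_integral => y _; rewrite !patchE.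
  have -> : ((x, y) \in pt @^-1` open_Gamma) =
     (y \in (if 0 < x then `]0, 1 - x[%classic else set0 : set R)).
    apply/idP/idP; rewrite !inE /= /open_Gamma/= !mxE/=; case: ifP => // x0.
    - by case=> _ y0 xy; rewrite /= in_itv/= y0/=; lra.
    - by case.
    - by rewrite /= in_itv/= => /andP[y0 xy]; split => //; lra.
  by case: ifP.
case: ifPn => x0; last first.
  rewrite mem_oo (negbTE x0)/=.
  by transitivity (0%E : \bar R) => //; apply: integral0_eq => y _; rewrite patchE in_set0.
have dG (y : R) : is_derive y 1 (fun y => G (pt (x, y))) ('D_(delta_mx 0 1) G (pt (x, y))).
  rewrite (_ : (fun y => G (pt (x, y))) = fun t => G (pt (x, 0) + t *: delta_mx 0 1)).
    by rewrite (pt_line2 x y); exact/derive_line/(proj1 CG).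
  by apply/funext => t; rewrite (pt_line2 x t).
rewrite (integral_slice _ _ dG).
- by rewrite subr_gt0 mem_oo x0.
- exact: (@continuous_pt2 ('D_(delta_mx 0 1) G) x cD).
Qed.

End ReferenceDivergence.

(** * The divergence theorem on the reference triangle *)

Section DivergenceTheorem.
Variable R : realType.
Local Notation V := 'rV[R]_2.
Local Notation mR := (measurableTypeR R).
Local Notation mu := (@lebesgue_measure R).
Local Notation pt := (@pt R).

(** The edges run from lower to higher vertex, which is not a consistent orientation of the
    boundary: [rot90] of the tangent points outwards on e_12 and e_23 but inwards on e_13. *)
Definition edge_sign (s : edge) : R := if s is E13 then -1 else 1.

Lemma edge_ptE (s : edge) (t : R) :
  edge_pt s t = vpt (lo s) + t *: tangent R s.
Proof. by rewrite /edge_pt /tangent scalerBr scalerBl scale1r -addrA (addrC (- _)). Qed.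

Lemma edge_pt12 (t : R) : edge_pt E12 t = pt (0, t).
Proof. by apply: row2P; rewrite !mxE /=; ring. Qed.

Lemma edge_pt13 (t : R) : edge_pt E13 t = pt (t, 0).
Proof. by apply: row2P; rewrite !mxE /=; ring. Qed.

Lemma edge_pt23 (t : R) : edge_pt E23 t = pt (t, 1 - t).
Proof. by apply: row2P; rewrite !mxE /=; ring. Qed.

Lemma normal_compE (s : edge) (l : V) : normal_comp s l =
  match s with E12 => - l 0 0 | E13 => l 0 1 | E23 => l 0 0 + l 0 1 end.
Proof. by rewrite /normal_comp /dot sum2E !mxE; case: s => /=; rewrite !mxE /=; ring. Qed.

Lemma continuous_edge (g : V -> R) (s : edge) : continuous g ->
  continuous (fun t : R => g (edge_pt s t)).
Proof. by move=> cg; under eq_fun do rewrite edge_ptE; exact: continuous_line. Qed.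

Lemma integrable_01 (k : R -> R) : continuous k ->
  mu.-integrable `[0, 1] (EFin \o k).
Proof.
move=> ck; apply: continuous_compact_integrable; first exact: segment_compact.
exact: continuous_subspaceT.
Qed.

Lemma integral_oo_cc (k : R -> R) : continuous k ->
  (\int[mu]_(t in `]0%R, 1%R[) (k t)%:E = \int[mu]_(t in `[0%R, 1%R]) (k t)%:E)%E.
Proof.
move=> ck.
have mk (D : set mR) : measurable_fun D (EFin \o k).
  by apply/measurable_EFinP; apply: measurable_funTS; exact: continuous_measurable_fun.
rewrite (@integral_itv_bndo_bndc R (BRight 0) 1 (EFin \o k)); last exact: mk.
by rewrite (@integral_itv_obnd_cbnd R 0 (BRight 1) (EFin \o k)); last exact: mk.
Qed.

(** Needed for e_23, which the horizontal slices traverse from v_3 to v_2, against its own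
    parametrization. *)
Lemma Rintegral_reverse (k : R -> R) : continuous k ->
  \int[mu]_(t in `[0, 1]) k (1 - t) = \int[mu]_(t in `[0, 1]) k t.
Proof.
move=> ck; rewrite /Rintegral [in RHS]integration_by_substitution_onem ?ler01 ?lexx//.
  by rewrite unstable.onem1.
exact: continuous_subspaceT.
Qed.

Lemma sum_edges (F : edge -> R) : \sum_(s <- edges) F s = F E12 + F E13 + F E23.
Proof. by rewrite !big_cons big_nil addr0 addrA. Qed.

(** The xi component contributes on e_23 and e_12, the eta component on e_23 and e_13. The tangent
    is not normalized, so its rotation carries the edge length and the integrals over [0, 1] are
    genuine line integrals. *)
Lemma reference_divergence (W : V -> V) :
  (forall i, Ck 1 (fun x => W x 0 i)) ->
  int2 (@open_Gamma R) (fun x => \sum_i 'D_(delta_mx 0 i) (fun y => W y 0 i) x) =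
  \sum_(s <- edges) edge_sign s *
    \int[mu]_(t in `[0, 1]) normal_comp s (W (edge_pt s t)).
Proof.
move=> CW; have cW i := C1_continuous (CW i).
have mO := measurable_pt_open (@open_open_Gamma R).
have D1 := int2_open_Gamma1 (CW 0).
have D2 := int2_open_Gamma2 (CW 1).
have iD (i : 'I_2) : (@leb2 R).-integrable (pt @^-1` @open_Gamma R)
    (EFin \o (('D_(delta_mx 0 i) (fun y => W y 0 i)) \o pt)).
  by apply: continuous_integrable_open_Gamma; exact: (proj2 (CW i) (delta_mx 0 i)).
transitivity (\int[@leb2 R]_(z in pt @^-1` @open_Gamma R)
   ('D_(delta_mx 0 0) (fun y => W y 0 0) (pt z) +
    'D_(delta_mx 0 1) (fun y => W y 0 1) (pt z))).
  by apply: eq_Rintegral => z _; rewrite sum2E.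
rewrite RintegralD//; [|exact: iD|exact: iD].
rewrite [X in X + _ = _]/Rintegral [X in _ + X = _]/Rintegral D1 D2.
have c0 := continuous_edge (s := E23) (cW 0); have c1 := continuous_edge (s := E23) (cW 1).
have c2 := continuous_edge (s := E12) (cW 0); have c3 := continuous_edge (s := E13) (cW 1).
have c0' : continuous (fun t : R => W (edge_pt E23 (1 - t)) 0 0).
  move=> t; apply: (@continuous_comp _ _ _ (fun t : R => 1 - t) (fun t => W (edge_pt E23 t) 0 0)); last exact: c0.
  by apply: cvgB; [exact: cvg_cst|exact: cvg_id].
have A1 : fine (\int[mu]_(t in `]0%R, 1%R[) (W (pt (1 - t, t)) 0 0 - W (pt (0, t)) 0 0)%:E)%E
    = \int[mu]_(t in `[0, 1]) W (edge_pt E23 t) 0 0 - \int[mu]_(t in `[0, 1]) W (edge_pt E12 t) 0 0.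
  rewrite -[in RHS]Rintegral_reverse// -RintegralB//; [|exact: integrable_01|exact: integrable_01].
  rewrite [RHS]/Rintegral -integral_oo_cc; last by move=> t; apply: cvgB; [exact: c0'|exact: c2].
  by congr fine; apply: eq_integral => t _; rewrite edge_pt23 edge_pt12 subKr.
have A2 : fine (\int[mu]_(t in `]0%R, 1%R[) (W (pt (t, 1 - t)) 0 1 - W (pt (t, 0)) 0 1)%:E)%E
    = \int[mu]_(t in `[0, 1]) W (edge_pt E23 t) 0 1 - \int[mu]_(t in `[0, 1]) W (edge_pt E13 t) 0 1.
  rewrite -RintegralB//; [|exact: integrable_01|exact: integrable_01].
  rewrite [RHS]/Rintegral -integral_oo_cc; last by move=> t; apply: cvgB; [exact: c1|exact: c3].
  by congr fine; apply: eq_integral => t _; rewrite edge_pt23 edge_pt13.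
have N12 : \int[mu]_(t in `[0, 1]) normal_comp E12 (W (edge_pt E12 t)) =
    - \int[mu]_(t in `[0, 1]) W (edge_pt E12 t) 0 0.
  rewrite -mulN1r -RintegralZl//; last exact: integrable_01.
  by apply: eq_Rintegral => t _; rewrite normal_compE mulN1r.
have N13 : \int[mu]_(t in `[0, 1]) normal_comp E13 (W (edge_pt E13 t)) =
    \int[mu]_(t in `[0, 1]) W (edge_pt E13 t) 0 1.
  by apply: eq_Rintegral => t _; rewrite normal_compE.
have N23 : \int[mu]_(t in `[0, 1]) normal_comp E23 (W (edge_pt E23 t)) =
    \int[mu]_(t in `[0, 1]) W (edge_pt E23 t) 0 0 + \int[mu]_(t in `[0, 1]) W (edge_pt E23 t) 0 1.
  rewrite -RintegralD//; [|exact: integrable_01|exact: integrable_01].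
  by apply: eq_Rintegral => t _; rewrite normal_compE.
rewrite A1 A2 sum_edges N12 N13 N23 mul1r mulN1r mul1r.
move: (\int[mu]_(t in `[0, 1]) W (edge_pt E12 t) 0 0)
  (\int[mu]_(t in `[0, 1]) W (edge_pt E13 t) 0 1)
  (\int[mu]_(t in `[0, 1]) W (edge_pt E23 t) 0 0)
  (\int[mu]_(t in `[0, 1]) W (edge_pt E23 t) 0 1) => a b c d.
ring.
Qed.

End DivergenceTheorem.

(** * Edges of the reference triangle *)

Section EdgeGeometry.
Variable R : realType.
Local Notation V := 'rV[R]_2.

Lemma dot2E (u v : V) : dot u v = u 0 0 * v 0 0 + u 0 1 * v 0 1.
Proof. by rewrite /dot sum2E. Qed.

(** The pairing [dot (rot90 u) v] is the determinant of the matrix with rows [u] and [v], hence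
    multiplicative. This is what makes the Piola transformation preserve fluxes. *)
Lemma dot_rot90_mulmx (u v : V) (J : 'M[R]_2) :
  dot (rot90 (u *m J)) (v *m J) = \det J * dot (rot90 u) v.
Proof. by rewrite !dot2E det2E !mxE !sum2E /=; ring. Qed.

Lemma normal_compZ s a (l : V) : normal_comp s (a *: l) = a * normal_comp s l.
Proof. by rewrite !normal_compE; case: s; rewrite !mxE; ring. Qed.

Lemma normal_comp0 s : normal_comp s (0 : V) = 0.
Proof. by rewrite -(scale0r 0) normal_compZ mul0r. Qed.

Lemma dot_rot90_self (u : V) : dot (rot90 u) u = 0.
Proof. by rewrite dot2E !mxE /=; ring. Qed.

Lemma dot_neq0 (u : V) : u != 0 -> dot u u != 0.
Proof.
apply: contraNneq; rewrite dot2E => q0; apply/eqP/row2P; rewrite mxE;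
  by apply/eqP; rewrite -sqrf_eq0 expr2; apply/eqP; have := sqr_ge0 (u 0 0);
     have := sqr_ge0 (u 0 1); rewrite !expr2; lra.
Qed.

Lemma rot90_colinear (tau w : V) : tau != 0 -> dot (rot90 tau) w = 0 ->
  exists a, w = a *: tau.
Proof.
move=> /dot_neq0 tt tw; exists (dot tau w / dot tau tau).
move: tt tw; rewrite !dot2E !mxE /= => tt tw.
apply: row2P; rewrite mxE; apply: (mulfI tt); rewrite [RHS]mulrA [X in _ = X * _]mulrC divfK//.
- apply/eqP; rewrite -subr_eq0; apply/eqP.
  transitivity (- tau 0 1 * (- tau 0 1 * w 0 0 + tau 0 0 * w 0 1)); [ring|by rewrite tw mulr0].
- apply/eqP; rewrite -subr_eq0; apply/eqP.
  transitivity (tau 0 0 * (- tau 0 1 * w 0 0 + tau 0 0 * w 0 1)); [ring|by rewrite tw mulr0].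
Qed.

Lemma normal_colinear (n tau : V) : tau != 0 -> dot n tau = 0 ->
  exists c, forall v, dot n v = c * dot (rot90 tau) v.
Proof.
move=> tau0 ntau.
have := dot_neq0 tau0; rewrite dot2E -!expr2 => q0.
(* The coefficient of the orthogonal projection of [n] on [rot90 tau]. *)
exists ((n 0 1 * tau 0 0 - n 0 0 * tau 0 1) / (tau 0 0 ^+ 2 + tau 0 1 ^+ 2)) => v.
move: ntau; rewrite !dot2E !mxE /= => ntau.
apply: (mulfI q0); rewrite mulrA (mulrC _ (_ / _)) divfK//.
transitivity ((n 0 1 * tau 0 0 - n 0 0 * tau 0 1) * (- tau 0 1 * v 0 0 + tau 0 0 * v 0 1)
  + (n 0 0 * tau 0 0 + n 0 1 * tau 0 1) * (tau 0 0 * v 0 0 + tau 0 1 * v 0 1)); first by ring.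
by rewrite ntau; ring.
Qed.

Lemma tangent_neq0 s : tangent R s != 0.
Proof.
by apply/eqP => /rowP h; move: (h 0) (h 1); rewrite !mxE; case: s h => h /=;
  rewrite !mxE /= => h0 h1; lra.
Qed.

Lemma edge_pt_Gamma s (t : R) : 0 <= t <= 1 -> Gamma R (edge_pt s t).
Proof.
move=> /andP[t0 t1]; case: s; rewrite ?edge_pt12 ?edge_pt13 ?edge_pt23;
  by split; rewrite !mxE /=; try (apply/andP; split); lra.
Qed.

Lemma edge_set_pt s (t : R) : 0 <= t <= 1 -> edge_set s (edge_pt s t).
Proof. by move=> t01; exists t => //=; rewrite in_itv. Qed.

Lemma edge_set_Gamma s : edge_set s `<=` Gamma R.
Proof. by move=> _ [t /= t01 <-]; apply: edge_pt_Gamma; rewrite in_itv in t01. Qed.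

Lemma vpt_lo s : edge_pt s 0 = vpt (lo s) :> V.
Proof. by rewrite /edge_pt subr0 scale1r scale0r addr0. Qed.

Lemma vpt_hi s : edge_pt s 1 = vpt (hi s) :> V.
Proof. by rewrite /edge_pt subrr scale1r scale0r add0r. Qed.

Lemma vpt_Gamma i : Gamma R (vpt i).
Proof.
by case: i; [rewrite -(vpt_lo E12)|rewrite -(vpt_hi E12)|rewrite -(vpt_hi E13)];
  apply: edge_pt_Gamma; rewrite ?lexx ?ler01.
Qed.

Lemma vpt_inj : injective (@vpt R).
Proof.
move=> i j /rowP h; move: (h 0) (h 1); clear h.
by case: i; case: j => //=; rewrite !mxE /= => h0 h1; exfalso; lra.
Qed.

Lemma edge_interior s s' (t : R) : 0 < t < 1 -> edge_set s' (edge_pt s t) -> s' = s.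
Proof.
move=> /andP[t0 t1] [t' _ /rowP h]; move: (h 0) (h 1); clear h.
by case: s; case: s' => //=; rewrite ?edge_pt12 ?edge_pt13 ?edge_pt23 !mxE /= => h0 h1;
   exfalso; lra.
Qed.

Lemma edge_pt_not_vpt s (t : R) i : 0 < t < 1 -> edge_pt s t <> vpt i.
Proof.
move=> /andP[t0 t1] /rowP h; move: (h 0) (h 1); clear h.
by case: s; case: i => //=; rewrite ?edge_pt12 ?edge_pt13 ?edge_pt23 !mxE /= => h0 h1; lra.
Qed.

(** The functions agree on [0, 1] only, but a derivative that exists is determined by one-sided
    quotients: from the right when [t < 1], from the left at [t = 1]. This covers the end points of
    an edge. *)
Lemma derive_eq_itv (W : normedModType R) (g h : R -> W) (t : R) :
  0 <= t <= 1 -> (forall x, 0 <= x <= 1 -> g x = h x) ->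
  derivable g t 1 -> derivable h t 1 -> 'D_1 g t = 'D_1 h t.
Proof.
move=> t01 gh dg dh; apply/eqP; rewrite -subr_eq0 -deriveB//; apply/eqP.
have dd : derivable (g - h) t 1 by exact: derivableB.
rewrite /derivable /= in dd; rewrite /derive /=.
have gh0 x : 0 <= x <= 1 -> (g - h) x = 0 by move=> x01; rewrite fctE gh ?subrr.
have [t1|t1] := ltP t 1.
- rewrite (cvg_at_rightE _ _ dd); apply: cvg_lim => //; apply: cvg_near_cst.
  near=> x; apply/eqP; rewrite [x%:A]mulr1 !gh0 ?subrr ?scaler0//.
  have x0 : 0 < x by near: x; exact: nbhs_right_gt.
  have x1 : x < 1 - t by near: x; apply: nbhs_right_lt; lra.
  by apply/andP; split; lra.
- rewrite (cvg_at_leftE _ _ dd); apply: cvg_lim => //; apply: cvg_near_cst.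
  near=> x; apply/eqP; rewrite [x%:A]mulr1 !gh0 ?subrr ?scaler0//.
  have x0 : x < 0 by near: x; exact: nbhs_left_lt.
  have x1 : - t < x by near: x; apply: nbhs_left_gt; lra.
  by apply/andP; split; lra.
Unshelve. all: end_near. Qed.

End EdgeGeometry.

(** * Normal traces *)

Section MeshLemmas.
Variables (R : realType) (E : finType) (M : E -> 'rV[R]_2 -> 'rV[R]_2).
Hypothesis hM : conforming_mesh M.
Local Notation V := 'rV[R]_2.

Lemma inv_mapK e x : Gamma R x -> inv_map M e (M e x) = x.
Proof. by move=> Gx; rewrite /inv_map pinvKV ?inE//; exact: (map_inj hM). Qed.

Lemma map_injP e x y : Gamma R x -> Gamma R y -> M e x = M e y -> x = y.
Proof. by move=> Gx Gy; apply: (map_inj hM); rewrite inE. Qed.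

Lemma image_edge_inj e s s' : M e @` edge_set s = M e @` edge_set s' -> s = s'.
Proof.
move=> ss'; have h : 0 < (2^-1 : R) < 1 by apply/andP; split; lra.
have [y sy] : (M e @` edge_set s') (M e (edge_pt s 2^-1)).
  rewrite -ss'; exists (edge_pt s 2^-1) => //; apply: edge_set_pt; lra.
move=> /map_injP yE; apply/esym/(edge_interior h).
rewrite -yE//; first exact: edge_set_Gamma sy.
by apply: edge_pt_Gamma; lra.
Qed.

Lemma interface_edge_pt e s f s' t : interface M e s f s' -> 0 <= t <= 1 ->
  M e (edge_pt s t) = M f (edge_pt s' t).
Proof. by move=> [_ ss'] t01; exact: (mesh_match hM). Qed.

Lemma interface_sym e s f s' : interface M e s f s' -> interface M f s' e s.
Proof. by move=> [ef ss']; split; [rewrite eq_sym|rewrite ss']. Qed.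

(** The two parametrizations of the common edge coincide, so their velocities do too; this holds for
    curved edges as well. *)
Lemma interface_tangent e s f s' t : interface M e s f s' -> 0 <= t <= 1 ->
  tangent R s *m jacobian (M e) (edge_pt s t) =
  tangent R s' *m jacobian (M f) (edge_pt s' t).
Proof.
move=> es t01.
have dl e' s0 : is_derive t 1 (fun x => M e' (vpt (lo s0) + x *: tangent R s0))
    ('D_(tangent R s0) (M e') (vpt (lo s0) + t *: tangent R s0)).
  apply: derive_line; rewrite -edge_ptE; apply: (map_diff hM); exact: edge_pt_Gamma.
have de e' s0 : 'D_(tangent R s0) (M e') (vpt (lo s0) + t *: tangent R s0) =
    tangent R s0 *m jacobian (M e') (edge_pt s0 t).
  rewrite -edge_ptE deriveEjacobian//; apply: (map_diff hM); exact: edge_pt_Gamma.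
rewrite -!de; have [d1 e1] := dl e s; have [d2 e2] := dl f s'; rewrite -e1 -e2.
apply: (derive_eq_itv t01 _ d1 d2) => x x01.
by rewrite -!edge_ptE; exact: interface_edge_pt es x01.
Qed.

Lemma normal_direction e s (xi n : V) : Gamma R xi ->
  dot n (tangent R s *m jacobian (M e) xi) = 0 ->
  exists c, forall v, dot n v = c * dot (rot90 (tangent R s *m jacobian (M e) xi)) v.
Proof.
move=> Gxi; apply: normal_colinear.
apply: contraNneq (tangent_neq0 R s) => /(congr1 (mulmx^~ (invmx (jacobian (M e) xi)))).
by rewrite mulmxK ?unitmxE ?unitfE ?(map_det hM)// mul0mx => ->.
Qed.

Lemma piola_normal_trace e s (xi n : V) c phi : Gamma R xi ->
  (forall v, dot n v = c * dot (rot90 (tangent R s *m jacobian (M e) xi)) v) ->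
  dot n (piola M e phi (M e xi)) = c * normal_comp s (phi xi).
Proof.
move=> Gxi nc; have D0 := map_det hM e Gxi.
rewrite nc /piola inv_mapK//; congr (c * _).
rewrite -[RHS]mul1r -(mulVf D0) -mulrA -dot_rot90_mulmx !dot2E !mxE /=; ring.
Qed.

(** The way back from absent jumps to equal reference fluxes. The choice [n = rot90 tau] makes the
    common factor equal to 1 on both sides. *)
Lemma no_jump_trace u e s f s' t phi psi : no_normal_jump M u ->
  u e = piola M e phi -> u f = piola M f psi ->
  interface M e s f s' -> 0 <= t <= 1 ->
  normal_comp s (phi (edge_pt s t)) = normal_comp s' (psi (edge_pt s' t)).
Proof.
move=> jump ue uf es t01; pose tau := tangent R s *m jacobian (M e) (edge_pt s t).
have tau0 : dot (rot90 tau) tau = 0 := dot_rot90_self tau.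
have J := jump _ _ _ _ es _ (edge_set_pt s t01) (rot90 tau) tau0.
rewrite ue uf in J.
have n1 v : dot (rot90 tau) v = 1 * dot (rot90 tau) v by rewrite mul1r.
have n2 v : dot (rot90 tau) v =
    1 * dot (rot90 (tangent R s' *m jacobian (M f) (edge_pt s' t))) v.
  by rewrite -(interface_tangent es t01); exact: n1.
have t1 := piola_normal_trace phi (edge_pt_Gamma s t01) n1.
have t2 := piola_normal_trace psi (edge_pt_Gamma s' t01) n2.
rewrite -(interface_edge_pt es t01) in t2; rewrite !mul1r in t1 t2.
exact: (etrans (esym t1) (etrans J t2)).
Qed.

End MeshLemmas.

(** * Fluxes of the base functions and H1-conformity *)

Section NormalTrace.
Variables (R : realType) (p : nat) (U : h1_basis R p).
Hypotheses (hU : polynomial_basis U) (hconf : h1_conforming U).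
Local Notation V := 'rV[R]_2.
Local Notation T := (hdiv_template R).

Definition slot_fun (s : edge) (c : slot p) : poly2 R :=
  match c with
  | Lower => vfun U (lo s)
  | Upper => vfun U (hi s)
  | Inner k => efun U s k
  end.

Definition slot_dirs (s : edge) (c : slot p) : seq V :=
  match c with Lower => tv T (lo s) | Upper => tv T (hi s) | Inner _ => te T s end.

Lemma edge_productsP s c phi : edge_products U T s c phi ->
  exists l, [/\ l \in slot_dirs s c, normal_comp s l != 0 & phi = product (slot_fun s c) l].
Proof. by case: c => [||k] /= [l [lT ln] <-]; exists l. Qed.

Lemma normal_comp_product s n (l : V) x :
  normal_comp s (product n l x) = eval2 n x * normal_comp s l.
Proof. by rewrite normal_compZ. Qed.

(** The signs in the template are adapted to [rot90 (tangent R s)]. On e_23 this normal is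
    [e1 + e2], whose square length 2 explains the factor 1/2 in the list of that edge. *)
Lemma normal_comp_slot s c l : l \in slot_dirs s c -> normal_comp s l != 0 ->
  normal_comp s l = -1.
Proof.
by case: c => [||k]; case: s => /=; rewrite !inE => /orP[] /eqP -> ;
  rewrite !normal_compE !mxE /= => h; (have {}h := elimN eqP h); lra.
Qed.

Lemma edge_trace s c phi x : edge_products U T s c phi ->
  normal_comp s (phi x) = - eval2 (slot_fun s c) x.
Proof.
move=> /edge_productsP[l [lT ln ->]].
by rewrite normal_comp_product (normal_comp_slot lT ln) mulrN1.
Qed.

(** An edge function vanishes on [s']. A vertex function vanishes there if [s'] is opposite to the
    vertex; otherwise [s'] is the second edge at this vertex, and the vector that crosses [s] is
    parallel to it. *)
Lemma edge_trace_other s s' c phi t : s <> s' -> 0 <= t <= 1 ->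
  edge_products U T s c phi -> normal_comp s' (phi (edge_pt s' t)) = 0.
Proof.
move=> ss' t01 /edge_productsP[l [lT ln ->]]; rewrite normal_comp_product.
have ev i : opposite i = s' -> eval2 (vfun U i) (edge_pt s' t) = 0.
  by move=> <-; apply: (vfun_edge hU); exact: edge_set_pt.
have ee k : eval2 (efun U s k) (edge_pt s' t) = 0.
  by apply: (efun_edge hU) ss' _; exact: edge_set_pt.
case: c lT => [||k] lT /=; last by rewrite ee mul0r.
- have [/ev ->|o] := pselect (opposite (lo s) = s'); first by rewrite mul0r.
  suff -> : normal_comp s' l = 0 by rewrite mulr0.
  move: o ln lT; case: s ss' {ev ee} => ss'; case: s' ss' => //= ss' _ ln;
   rewrite !inE => /orP[] /eqP lE; move: ln; rewrite lE !normal_compE !mxE /= => h;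
   (have {}h := elimN eqP h); lra.
- have [/ev ->|o] := pselect (opposite (hi s) = s'); first by rewrite mul0r.
  suff -> : normal_comp s' l = 0 by rewrite mulr0.
  move: o ln lT; case: s ss' {ev ee} => ss'; case: s' ss' => //= ss' _ ln;
   rewrite !inE => /orP[] /eqP lE; move: ln; rewrite lE !normal_compE !mxE /= => h;
   (have {}h := elimN eqP h); lra.
Qed.

(** On its own edge an edge function comes with a tangential vector; everywhere else on the boundary
    the scalar factor vanishes. *)
Lemma cell_trace s phi t : 0 <= t <= 1 -> cell_products U T phi ->
  normal_comp s (phi (edge_pt s t)) = 0.
Proof.
move=> t01 [[s' [k [l [_ ln ->]]]]|[k [l [_ ->]]]]; rewrite normal_comp_product.
- have [<-|ss'] := pselect (s' = s); first by rewrite ln mulr0.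
  by rewrite (efun_edge hU k ss' (edge_set_pt s t01)) mul0r.
- by rewrite (cfun_edge hU k (edge_set_pt s t01)) mul0r.
Qed.

Section OnMesh.
Variables (E : finType) (M : E -> V -> V).
Hypothesis hM : conforming_mesh M.

Lemma h1_vertex e s f s' i i' t : interface M e s f s' -> 0 <= t <= 1 ->
  M e (vpt i) = M f (vpt i') ->
  eval2 (vfun U i) (edge_pt s t) = eval2 (vfun U i') (edge_pt s' t).
Proof.
move=> es t01 ii'.
(* The assembled scalar function of the global vertex [M e (vpt i)]. The local vertex picked by
   choice on [e'] is the expected one because [M e'] and [vpt] are injective. *)
pose w e' : V -> R := if pselect (exists j, M e' (vpt j) = M e (vpt i)) is left h
  then pull M e' (vfun U (projT1 (cid h))) else fun=> 0.
have wE e' j : M e' (vpt j) = M e (vpt i) -> w e' = pull M e' (vfun U j).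
  move=> jE; rewrite /w; case: pselect => [h|[]]; last by exists j.
  case: (cid h) => j' /= j'E; congr (pull M e' (vfun U _)); apply: (@vpt_inj R).
  by apply: (map_injP hM (e := e') (vpt_Gamma _ _) (vpt_Gamma _ _)); rewrite j'E.
have wa : h1_assembled U M w.
  apply: Or31; exists (M e (vpt i)) => e'; split=> [j /wE //|nj].
  by rewrite /w; case: pselect => // h; exfalso; case: h => j /nj.
have x : (M e @` edge_set s) (M e (edge_pt s t)).
  by exists (edge_pt s t) => //; exact: edge_set_pt.
have := hconf hM wa es x; rewrite (wE e i)// (wE f i')//.
by rewrite /pull {2}(interface_edge_pt hM es t01) !inv_mapK//; exact: edge_pt_Gamma.
Qed.

Lemma h1_edge e s f s' k t : interface M e s f s' -> 0 <= t <= 1 ->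
  eval2 (efun U s k) (edge_pt s t) = eval2 (efun U s' k) (edge_pt s' t).
Proof.
move=> es t01; have ss' := proj2 es.
pose w e' : V -> R := if pselect (exists j, M e' @` edge_set j = M e @` edge_set s) is left h
  then pull M e' (efun U (projT1 (cid h)) k) else fun=> 0.
have wE e' j : M e' @` edge_set j = M e @` edge_set s -> w e' = pull M e' (efun U j k).
  move=> jE; rewrite /w; case: pselect => [h|[]]; last by exists j.
  case: (cid h) => j' /= j'E; congr (pull M e' (efun U _ k)).
  by apply: (image_edge_inj hM (e := e')); rewrite j'E.
have wa : h1_assembled U M w.
  apply: Or32; exists (M e @` edge_set s), k => e'; split=> [j /wE //|nj].
  by rewrite /w; case: pselect => // h; exfalso; case: h => j /nj.
have x : (M e @` edge_set s) (M e (edge_pt s t)).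
  by exists (edge_pt s t) => //; exact: edge_set_pt.
have := hconf hM wa es x; rewrite (wE e s)// (wE f s')//.
by rewrite /pull {2}(interface_edge_pt hM es t01) !inv_mapK//; exact: edge_pt_Gamma.
Qed.

(** Matching parametrizations send lower vertex to lower vertex ([t = 0]) and higher to higher
    ([t = 1]), so a slot denotes the same global vertex or edge on both sides. *)
Lemma slot_fun_match e s f s' c t : interface M e s f s' -> 0 <= t <= 1 ->
  eval2 (slot_fun s c) (edge_pt s t) = eval2 (slot_fun s' c) (edge_pt s' t).
Proof.
move=> es t01; case: c => [||k] /=.
- apply: (h1_vertex es t01); rewrite -!vpt_lo; apply: (interface_edge_pt hM es).
  by rewrite lexx ler01.
- apply: (h1_vertex es t01); rewrite -!vpt_hi; apply: (interface_edge_pt hM es).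
  by rewrite lexx ler01.
- exact: (h1_edge k es t01).
Qed.

Lemma piola0 e : piola M e (fun=> 0) = fun=> 0.
Proof. by apply/funext => x; rewrite /piola mul0mx scaler0. Qed.

Lemma assembled_trace w e s f s' t : hdiv_assembled U T M w ->
  interface M e s f s' -> 0 <= t <= 1 ->
  exists phi psi, [/\ w e = piola M e phi, w f = piola M f psi &
    normal_comp s (phi (edge_pt s t)) = normal_comp s' (psi (edge_pt s' t))].
Proof.
move=> wa es t01; have ss' := proj2 es.
case: wa => [[S [c wc]]|[phi cphi [e0 wc]]].
- have same e' j : M e' @` edge_set j = S -> exists2 phi, edge_products U T j c phi & w e' = piola M e' phi.
    by move=> jS; have [/(_ _ jS) [phi ? <-] _] := wc e'; exists phi.
  (* Here [e'] either has the global edge [S] under another local name, or does not have it and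
     carries the zero field, the Piola image of zero. *)
  have other e' j : M e' @` edge_set j <> S -> exists2 phi,
      normal_comp j (phi (edge_pt j t)) = 0 & w e' = piola M e' phi.
    move=> jS; have [[j' j'S]|nj] := pselect (exists j', M e' @` edge_set j' = S).
      have [phi phij' ->] := same _ _ j'S; exists phi => //.
      by apply: edge_trace_other phij' => // j'j; apply: jS; rewrite -j'j.
    exists (fun=> 0); first exact: normal_comp0.
    by rewrite piola0; have [_ ->//] := wc e' => l lS; apply: nj; exists l.
  have [sS|sS] := pselect (M e @` edge_set s = S).
    have [phi phis we] := same _ _ sS.
    have [psi psis wf] := same f s' (etrans (esym ss') sS).
    exists phi, psi; split=> //.
    by rewrite (edge_trace _ phis) (edge_trace _ psis) (slot_fun_match c es t01).
  have [phi phi0 we] := other _ _ sS.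
  have [psi psi0 wf] : exists2 psi, normal_comp s' (psi (edge_pt s' t)) = 0 & w f = piola M f psi.
    by apply: other; rewrite -ss'.
  by exists phi, psi; rewrite phi0 psi0.
- have any e' j : exists2 phi, normal_comp j (phi (edge_pt j t)) = 0 & w e' = piola M e' phi.
    have [w1 w2] := wc e'; have [ee0|ee0] := eqVneq e' e0.
      by exists phi; [exact: cell_trace|exact: w1 tt ee0].
    exists (fun=> 0); first exact: normal_comp0.
    by rewrite piola0; apply: w2 => _ /eqP; rewrite (negbTE ee0).
  have [phi1 h1 we] := any e s; have [phi2 h2 wf] := any f s'.
  by exists phi1, phi2; rewrite h1 h2.
Qed.

Lemma dot_sumr (n : V) (m : nat) (a : 'I_m -> R) (v : 'I_m -> V) :
  dot n (\sum_i a i *: v i) = \sum_i a i * dot n (v i).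
Proof.
rewrite /dot; under [RHS]eq_bigr do rewrite mulr_sumr.
rewrite exchange_big /=; apply: eq_bigr => j _; rewrite summxE mulr_sumr.
by apply: eq_bigr => i _; rewrite !mxE mulrCA.
Qed.

Lemma interface_trace e s f s' t (n : V) phi psi : interface M e s f s' ->
  0 <= t <= 1 -> dot n (tangent R s *m jacobian (M e) (edge_pt s t)) = 0 ->
  normal_comp s (phi (edge_pt s t)) = normal_comp s' (psi (edge_pt s' t)) ->
  dot n (piola M e phi (M e (edge_pt s t))) = dot n (piola M f psi (M e (edge_pt s t))).
Proof.
move=> es t01 ntau tr.
have Gs := @edge_pt_Gamma R s t t01; have Gs' := @edge_pt_Gamma R s' t t01.
have [c nc] := normal_direction hM Gs ntau.
have nc' v : dot n v = c * dot (rot90 (tangent R s' *m jacobian (M f) (edge_pt s' t))) v.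
  by rewrite -(interface_tangent hM es t01); exact: nc.
apply: (etrans (piola_normal_trace hM phi Gs nc)).
rewrite (interface_edge_pt hM es t01).
by apply: (etrans _ (esym (piola_normal_trace hM psi Gs' nc'))); rewrite tr.
Qed.

Lemma hdiv_space_no_jump u : hdiv_space U T M u -> no_normal_jump M u.
Proof.
move=> [m [a [w [wa uE]]]] e s f s' es xi [t t01 <-] n ntau.
have {}t01 : 0 <= t <= 1 by move: t01; rewrite /= in_itv.
rewrite !uE !dot_sumr; apply: eq_bigr => i _; congr (_ * _).
have [phi [psi [we wf tr]]] := assembled_trace (wa i) es t01.
rewrite we wf; exact: interface_trace tr.
Qed.

End OnMesh.
End NormalTrace.

(** * Affine meshes *)

Section AffineMesh.
Variables (R : realType) (E : finType) (M : E -> 'rV[R]_2 -> 'rV[R]_2).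
Hypothesis hM : conforming_mesh M.
Variables (B : E -> 'M[R]_2) (b : E -> 'rV[R]_2).
Hypothesis MB : forall e, M e = fun x => x *m B e + b e.
Local Notation V := 'rV[R]_2.

Lemma jacobian_affine e x : jacobian (M e) x = B e.
Proof.
apply/row_matrixP => i; rewrite !rowE MB.
rewrite -deriveEjacobian; last exact: affine_differentiable.
by rewrite (@derive_affine R V id) derive_id.
Qed.

Lemma det_affine e : \det (B e) != 0.
Proof. by rewrite -(jacobian_affine e 0); apply: (map_det hM); exact: (vpt_Gamma R V1). Qed.

(** In contrast to [inv_map], this inverse is continuous and correct on the whole plane. *)
Definition Minv e (x : V) : V := x *m invmx (B e) + (- b e *m invmx (B e)).

Lemma B_unit e : B e \in unitmx.
Proof. by rewrite unitmxE unitfE det_affine. Qed.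

Lemma MinvK e x : M e (Minv e x) = x.
Proof. by rewrite MB /Minv -mulmxDl mulmxKV ?B_unit// subrK. Qed.

Lemma MK e x : Minv e (M e x) = x.
Proof. by rewrite MB /Minv -mulmxDl addrK mulmxK ?B_unit. Qed.

Lemma Minv_continuous e : continuous (Minv e).
Proof. exact: affine_continuous. Qed.

Lemma M_continuous e : continuous (M e).
Proof. by rewrite MB; exact: affine_continuous. Qed.

Lemma inv_mapE e x : (M e @` Gamma R) x -> inv_map M e x = Minv e x.
Proof. by move=> [y Gy <-]; rewrite MK inv_mapK. Qed.

Lemma image_affine e (A : set V) : M e @` A = Minv e @^-1` A.
Proof.
apply/seteqP; split => [_ [y Ay <-]|x Ax]; first by rewrite /= MK.
by exists (Minv e x) => //; exact: MinvK.
Qed.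

Definition elt e : set V := (M e @` Gamma R)°.

Lemma elt_open e : open (elt e).
Proof. exact: open_interior. Qed.

Lemma elt_sub_image e : elt e `<=` M e @` Gamma R.
Proof. exact: interior_subset. Qed.

(** Elements enter [piecewise] through their interiors, so integrals over them are pulled back to
    the open triangle. *)
Lemma preimage_elt e : M e @^-1` elt e = @open_Gamma R.
Proof.
apply/seteqP; split => x /=; last first.
  move=> Ox; rewrite /elt image_affine /interior /=.
  apply: (@filterS _ _ _ (Minv e @^-1` @open_Gamma R)).
    by move=> y /=; exact: open_Gamma_sub.
  apply: open_nbhs_nbhs; split; last by rewrite /= MK.
  by apply: open_comp; [move=> ? _; exact: Minv_continuous|exact: open_open_Gamma].
move=> Ex.
(* moving away from the barycentre keeps an interior point inside the triangle *)
pose c : V := pt (3^-1, 3^-1).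
pose line (d : R) : V := M e (x + d *: (x - c)).
have lc : continuous line.
  move=> d; apply: (@continuous_comp _ _ _ (fun d : R => x + d *: (x - c)) (M e)); last exact: M_continuous.
  apply: differentiable_continuous; apply: differentiableD; first exact: differentiable_cst.
  by apply: (@differentiableZl _ _ _ (id : R -> R)).
have l0 : \forall d \near (0 : R), (M e @` Gamma R) (line d).
  have : nbhs (line 0) (M e @` Gamma R) by rewrite /line scale0r addr0.
  exact: lc.
have /nbhs_ballP[r /= r0 rl] := l0.
have [|y Gy] := rl (r / 2).
  by rewrite /ball /= sub0r normrN gtr0_norm ?divr_gt0// ltr_pdivrMr// mulr_natr mulr2n ltrDl.
move=> /(congr1 (Minv e)); rewrite !MK => yE; move: Gy; rewrite yE => -[].
rewrite /c !mxE /= => /andP[h1 _] /andP[h2 _] h3.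
have d0 : 0 < r / 2 by rewrite divr_gt0.
by split; nra.
Qed.

Definition apex (s : edge) : vertex := match s with E12 => V3 | E13 => V2 | E23 => V1 end.
Definition inward (s : edge) : V := vpt (apex s) - vpt (lo s).

Lemma normal_comp_inward s : normal_comp s (inward s) = - edge_sign R s.
Proof. by rewrite normal_compE; case: s => /=; rewrite !mxE /=; ring. Qed.

(** The point has barycentric coordinates [1 - r - q], [r] and [q] with respect to [lo s], [hi s]
    and [apex s]. *)
Lemma barycentric_Gamma s (r q : R) :
  Gamma R (edge_pt s r + q *: inward s) <-> [/\ 0 <= r, 0 <= q & r + q <= 1].
Proof.
by split; case: s; rewrite ?edge_pt12 ?edge_pt13 ?edge_pt23 /Gamma /inward /= !mxE /=;
  case=> [h1 h2 h3]; try move/andP: h1 => [h1 h1']; try move/andP: h2 => [h2 h2'];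
  split; try (apply/andP; split); lra.
Qed.

Lemma M_barycentric e s (r q : R) : M e (edge_pt s r + q *: inward s) =
  M e (edge_pt s 0) + r *: (tangent R s *m B e) + q *: (inward s *m B e).
Proof.
rewrite !MB (edge_ptE _ r) vpt_lo.
move: (tangent R s) (inward s) (vpt (lo s)) => T N L; rewrite !mulmxDl -!scalemxAl.
by apply/rowP => j; rewrite !mxE; ring.
Qed.

(** The midpoint of the shared edge lies in both elements. It excludes an empty meet and a single
    vertex, and it lies on no edge other than [s]. *)
Lemma interface_meet e s f s' : interface M e s f s' ->
  M e @` Gamma R `&` M f @` Gamma R = M e @` edge_set s.
Proof.
move=> es; have [ef ss'] := es.
have inm t : 0 <= t <= 1 -> (M e @` Gamma R `&` M f @` Gamma R) (M e (edge_pt s t)).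
  move=> t01; split; first by exists (edge_pt s t) => //; exact: edge_pt_Gamma.
  by rewrite (interface_edge_pt hM es t01); exists (edge_pt s' t) => //; exact: edge_pt_Gamma.
have h01 : 0 < (2^-1 : R) < 1 by apply/andP; split; lra.
have h01' : 0 <= (2^-1 : R) <= 1 by apply/andP; split; lra.
have := inm _ h01'.
have [->//|[i [k [_ ->]]] /= /map_injP h|[s2 [s2' [_ ->]]] [y sy /map_injP yE]] := mesh_meet hM ef.
  by case: (edge_pt_not_vpt (i := i) h01 (h hM (edge_pt_Gamma _ h01') (vpt_Gamma _ _))).
have {}yE := yE hM (edge_set_Gamma sy) (edge_pt_Gamma _ h01').
by rewrite yE in sy; rewrite (edge_interior h01 sy).
Qed.

Lemma interface_opposite e s f s' : interface M e s f s' ->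
  (\det (B e) * edge_sign R s) * (\det (B f) * edge_sign R s') < 0.
Proof.
move=> es; set ke := _ * edge_sign R s; set kf := _ * edge_sign R s'.
have sgn0 s0 : edge_sign R s0 != 0 by case: s0; rewrite /edge_sign ?oner_eq0// oppr_eq0 oner_eq0.
have ke0 : ke != 0 by rewrite mulf_neq0// det_affine.
have kf0 : kf != 0 by rewrite mulf_neq0// det_affine.
have t0 : 0 <= (0 : R) <= 1 by rewrite lexx ler01.
pose Te := tangent R s *m B e; pose Ne := inward s *m B e; pose Nf := inward s' *m B f.
have Tf : tangent R s' *m B f = Te.
  by have := interface_tangent hM es t0; rewrite !jacobian_affine.
have cNe : dot (rot90 Te) Ne = - ke.
  by rewrite dot_rot90_mulmx -/(normal_comp s _) normal_comp_inward mulrN.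
have cNf : dot (rot90 Te) Nf = - kf.
  by rewrite -Tf dot_rot90_mulmx -/(normal_comp s' _) normal_comp_inward mulrN.
rewrite ltNge; apply/negP => kekf.
(* In the basis formed by the common tangent [Te] and the inward vector [Ne] of [e], the coefficient
   of [Nf] along [Ne] is [beta]; equal signs mean that [Nf] also points into [e]. *)
pose beta := kf / ke.
have beta0 : 0 < beta.
  have oo : 0 < ke * kf by rewrite lt_def mulf_neq0.
  by rewrite /beta -(pmulr_lgt0 (x := ke ^+ 2)) ?exprn_even_gt0// expr2 mulrA divfK// mulrC.
have Te0 : Te != 0.
  apply: contra_neq ke0 => Te0; move: cNe; rewrite Te0 dot2E !mxE /= => h; lra.
have [a NfE] : exists a, Nf = a *: Te + beta *: Ne.
  have [|a aE] := rot90_colinear (w := Nf - beta *: Ne) Te0.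
    have -> : dot (rot90 Te) (Nf - beta *: Ne) = dot (rot90 Te) Nf - beta * dot (rot90 Te) Ne.
      by rewrite !dot2E !mxE /=; ring.
    by rewrite cNe cNf /beta mulrN divfK// subrr.
  by exists a; rewrite -aE subrK.
(* Chosen so that [ep * (1 + |a| + beta)] is 1/2: starting from the midpoint, the step [ep *: Nf]
   then satisfies the barycentric inequalities of both elements. *)
pose ep := (2 * (1 + `|a| + beta))^-1.
have K0 : 0 < 1 + `|a| + beta by have := normr_ge0 a; lra.
have ep0 : 0 < ep by rewrite invr_gt0 mulr_gt0.
have epE : ep + ep * `|a| + ep * beta = 2^-1.
  rewrite -[X in X + _ + _]mulr1 -!mulrDr /ep invfM -mulrA mulVf ?mulr1//; lra.
have epb : 0 < ep * beta by rewrite mulr_gt0.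
have epa : - (ep * `|a|) <= ep * a <= ep * `|a|.
  by rewrite -ler_norml normrM (gtr0_norm ep0).
have := interface_meet es; pose x := M f (edge_pt s' 2^-1 + ep *: inward s').
have xE : x = M e (edge_pt s (2^-1 + ep * a) + (ep * beta) *: inward s).
  rewrite /x !M_barycentric -(interface_edge_pt hM es t0) Tf -/Te -/Ne -/Nf NfE.
  by rewrite scalerDr scalerDl !scalerA !addrA.
move/seteqP => [/(_ x) + _]; case.
  split.
    rewrite xE; exists (edge_pt s (2^-1 + ep * a) + (ep * beta) *: inward s) => //.
    by apply/barycentric_Gamma; move/andP: epa => [? ?]; split; lra.
  exists (edge_pt s' 2^-1 + ep *: inward s') => //.
  by apply/barycentric_Gamma; move/andP: epa => [? ?]; split; lra.
(* Common points lie on the edge, where the coordinate along [inward s] is 0, while here it is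
   [ep * beta > 0]. *)
move=> _ [t' _ <-]; rewrite xE => /(congr1 (Minv e)); rewrite !MK => /rowP h.
move: (h 0) (h 1); clear h xE x.
by case: (s); rewrite ?edge_pt12 ?edge_pt13 ?edge_pt23 /inward /= !mxE /= => h0 h1; lra.
Qed.

(** If no other element contained the point, [e] alone would cover a neighbourhood of it, which is
    impossible at a boundary point of [e]. A second element there meets [e] in a whole edge, since
    the point is not a vertex. *)
Lemma domain_edge_shared e s (t : R) : 0 < t < 1 -> domain M (M e (edge_pt s t)) ->
  exists f s', interface M e s f s'.
Proof.
move=> t01 dx; set x := M e (edge_pt s t) in dx.
have t01' : 0 <= t <= 1 by move/andP: t01 => [? ?]; apply/andP; split; lra.
have [[f [ef fx]]|nf] := pselect (exists f, e != f /\ (M f @` Gamma R) x).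
  have ex : (M e @` Gamma R) x by exists (edge_pt s t) => //; exact: edge_pt_Gamma.
  have inx : (M e @` Gamma R `&` M f @` Gamma R) x by [].
  have [h|[i [k [_ h]]]|[s2 [s2' [ss h]]]] := mesh_meet hM ef; move: inx; rewrite h//.
    move=> /= /(map_injP hM (edge_pt_Gamma _ t01') (vpt_Gamma _ _)).
    by move=> /(edge_pt_not_vpt t01).
  move=> [y sy /(map_injP hM (edge_set_Gamma sy) (edge_pt_Gamma _ t01')) yE].
  rewrite yE in sy; exists f, s2'; split=> //.
  by rewrite -(edge_interior t01 sy).
exfalso.
have cl f : closed (M f @` Gamma R).
  apply: compact_closed; first exact: norm_hausdorff.
  apply: continuous_compact; last exact: compact_Gamma.
  by apply: continuous_subspaceT; exact: M_continuous.
(* The other elements are finitely many closed sets that miss [x]. *)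
have near_e : \forall y \near x, (M e @` Gamma R) y.
  have : \forall y \near x, forall f, e != f -> ~ (M f @` Gamma R) y.
    apply: (@filter_forall V E (fun f y => e != f -> ~ (M f @` Gamma R) y) (nbhs x)) => f.
    have [ef|ef] := eqVneq e f; first by apply: nearW => y /eqP; case.
    have : nbhs x (~` (M f @` Gamma R)).
      apply: open_nbhs_nbhs; split; first exact: closed_openC.
      by move=> fx; apply: nf; exists f.
    by apply: filterS => y.
  have : nbhs x (\bigcup_f (M f @` Gamma R)) by exact: dx.
  apply: filterS2 => y [f _ fy] nfy.
  by have [ef|/nfy//] := eqVneq e f; move: fy; rewrite -ef.
pose line (d : R) : V := M e (edge_pt s t + d *: inward s).
have lc : continuous line.
  move=> d; apply: (@continuous_comp _ _ _ (fun d : R => edge_pt s t + d *: inward s) (M e)); last exact: M_continuous.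
  apply: differentiable_continuous; apply: differentiableD; first exact: differentiable_cst.
  by apply: (@differentiableZl _ _ _ (id : R -> R)).
have : nbhs (line 0) (M e @` Gamma R) by rewrite /line scale0r addr0.
move=> /lc /nbhs_ballP[r /= r0 rl].
(* A step against [inward s] makes the barycentric coordinate of the apex negative. *)
have [|y Gy] := rl (- (r / 2)).
  by rewrite /ball /= sub0r opprK gtr0_norm ?divr_gt0// ltr_pdivrMr// mulr_natr mulr2n ltrDl.
move=> /(congr1 (Minv e)); rewrite !MK => yE; move: Gy; rewrite yE => /barycentric_Gamma[_ h _].
have r2 : 0 < r / 2 by rewrite divr_gt0.
by lra.
Qed.

End AffineMesh.

(** * Piecewise fields on affine meshes *)

(** Spreading [b] over an antisymmetric array [c], with at most one nonzero entry per row, avoids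
    choosing a representative of each pair: the double sum equals its own opposite. *)
Lemma sum_antisymmetric_pairing (R : realType) (I : finType) (r : I -> I -> Prop)
    (b : I -> R) :
  (forall p q, r p q -> r q p) -> (forall p q q', r p q -> r p q' -> q = q') ->
  (forall p q, r p q -> b p = - b q) -> (forall p, (forall q, ~ r p q) -> b p = 0) ->
  \sum_p b p = 0.
Proof.
move=> rC rU rb b0; pose c p q : R := if `[< r p q >] then b p else 0.
have bE p : b p = \sum_q c p q.
  have [[q rpq]|nr] := pselect (exists q, r p q).
    rewrite (bigD1 q)//= big1 ?addr0 /c; first by rewrite (asboolT rpq).
    move=> q' q'q; rewrite asboolF// => /(rU _ _ _ rpq) qq'.
    by rewrite qq' eqxx in q'q.
  rewrite big1 => [|q _]; first by apply: b0 => q rpq; apply: nr; exists q.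
  by rewrite /c asboolF// => rpq; apply: nr; exists q.
have cN p q : c p q = - c q p.
  rewrite /c; have [rpq|nr] := pselect (r p q).
    by rewrite (asboolT rpq) (asboolT (rC _ _ rpq)); exact: rb.
  by rewrite !asboolF ?oppr0// => /rC.
suff : \sum_p \sum_q c p q = - \sum_p \sum_q c p q.
  by under eq_bigr do rewrite -bE; move=> h; lra.
rewrite {1}exchange_big -sumrN; apply: eq_bigr => q _; rewrite -sumrN.
by apply: eq_bigr => p _; exact: cN.
Qed.

Section C1Fields.
Variables (R : realType) (p : nat) (U : h1_basis R p) (T : template R).
Variables (E : finType) (M : E -> 'rV[R]_2 -> 'rV[R]_2).
Local Notation V := 'rV[R]_2.

Definition C1_field (phi : V -> V) : Prop := forall i, Ck 1 (fun x => phi x 0 i).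

Lemma C1_field_product n l : C1_field (product n l).
Proof.
move=> i; rewrite /product; under eq_fun do rewrite mxE.
by apply: C1M; [exact: C1_eval2|exact: C1_cst].
Qed.

Lemma C1_field0 : C1_field (fun=> 0).
Proof. by move=> i; under eq_fun do rewrite mxE; exact: C1_cst. Qed.

Lemma hdiv_assembled_C1 w e : hdiv_assembled U T M w ->
  exists2 phi, C1_field phi & w e = piola M e phi.
Proof.
case=> [[S [c wc]]|[phi cphi [e0 wc]]]; have [w1 w2] := wc e.
- have [[s sS]|ns] := pselect (exists s, M e @` edge_set s = S).
    have [phi ps <-] := w1 s sS; exists phi => //.
    by case: c ps {wc w1} => [||k] /= [l _ <-]; exact: C1_field_product.
  exists (fun=> 0); first exact: C1_field0.
  by rewrite piola0; apply: w2 => s sS; apply: ns; exists s.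
- have [ee0|ee0] := eqVneq e e0.
    exists phi; last exact: w1 tt ee0.
    by case: cphi => [[s [k [l [_ _ ->]]]]|[k [l [_ ->]]]]; exact: C1_field_product.
  exists (fun=> 0); first exact: C1_field0.
  by rewrite piola0; apply: w2 => _ /eqP; rewrite (negbTE ee0).
Qed.

(** The Piola transformation is linear in the reference field, so a combination of base functions is
    again the image of one C1 field per element. *)
Lemma hdiv_space_C1 u : hdiv_space U T M u ->
  exists phi : E -> V -> V, forall e, C1_field (phi e) /\ u e = piola M e (phi e).
Proof.
move=> [m [a [w [wa uE]]]].
suff [phi phiE] : {phi : E -> V -> V & forall e, C1_field (phi e) /\ u e = piola M e (phi e)}.
  by exists phi.
apply: (@choice _ _ (fun e phi => C1_field phi /\ u e = piola M e phi)) => e.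
have [ph phE] : {ph : 'I_m -> V -> V & forall i, C1_field (ph i) /\ w i e = piola M e (ph i)}.
  apply: (@choice _ _ (fun i phi => C1_field phi /\ w i e = piola M e phi)) => i.
  by have [phi ? ?] := hdiv_assembled_C1 e (wa i); exists phi.
exists (fun x => \sum_i a i *: ph i x); split.
  move=> j; under eq_fun do rewrite summxE; apply: C1_sum => i.
  under eq_fun do rewrite mxE.
  by apply: C1M; [exact: C1_cst|exact: (proj1 (phE i))].
apply/funext => x; rewrite uE /piola /= mulmx_suml scaler_sumr.
apply: eq_bigr => i _; rewrite (proj2 (phE i)) /piola /=.
by rewrite -scalemxAl !scalerA mulrC.
Qed.

End C1Fields.

(** * Piecewise continuous functions on an affine mesh *)

Section Assembly.
Variables (R : realType) (E : finType) (M : E -> 'rV[R]_2 -> 'rV[R]_2).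
Hypothesis hM : conforming_mesh M.
Variables (B : E -> 'M[R]_2) (b : E -> 'rV[R]_2).
Hypothesis MB : forall e, M e = fun x => x *m B e + b e.
Local Notation V := 'rV[R]_2.
Local Notation mR := (measurableTypeR R).
Local Notation mu := (@lebesgue_measure R).
Local Notation pt := (@pt R).
Local Notation elt := (elt M).
Local Notation A := (domain M).

Lemma uniform_bound (P : E -> R -> Prop) :
  (forall e C C', C <= C' -> P e C -> P e C') -> (forall e, exists C, P e C) ->
  exists C, forall e, P e C.
Proof.
move=> Pmono /choice[C PC]; exists (\sum_e `|C e|) => e; apply: Pmono (PC e).
by rewrite (bigD1 e)//= (le_trans (ler_norm _))// lerDl sumr_ge0.
Qed.

Lemma compact_elt e : compact (M e @` Gamma R).
Proof.
apply: continuous_compact; last exact: compact_Gamma.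
by apply: continuous_subspaceT; exact: (M_continuous MB).
Qed.

Lemma mesh_bounded : exists N, forall e x, (M e @` Gamma R) x ->
  `|x 0 0| <= N /\ `|x 0 1| <= N.
Proof.
apply: uniform_bound => [e C C' CC' PC x /PC[h1 h2]|e].
  by split; exact: le_trans CC'.
have c0 : continuous (fun x : V => x 0 0 : R) by exact: coord_continuous.
have c1 : continuous (fun x : V => x 0 1 : R) by exact: coord_continuous.
have [C0 h0] := continuous_compact_bounded (@compact_elt e) c0.
have [C1 h1] := continuous_compact_bounded (@compact_elt e) c1.
exists (Num.max C0 C1) => x ex.
by split; rewrite le_max ?h0 ?h1 ?orbT.
Qed.

Lemma mem_preimage_pt (D : set V) (z : mR * mR) : (z \in pt @^-1` D) = (pt z \in D).
Proof. by []. Qed.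

Definition pieces (h : E -> V -> R) : V -> R :=
  fun x => \sum_e \1_(elt e) x * h e x.

Lemma measurable_elt e : measurable (pt @^-1` elt e : set (mR * mR)).
Proof. by apply: measurable_pt_open; exact: elt_open. Qed.

Lemma measurable_domain : measurable (pt @^-1` A : set (mR * mR)).
Proof. by apply: measurable_pt_open; exact: open_interior. Qed.

Lemma elt_domain e : elt e `<=` A.
Proof. by apply: interiorS => x ex; exists e. Qed.

Lemma domain_bounded : exists N, forall x, A x -> `|x 0 0| <= N /\ `|x 0 1| <= N.
Proof.
have [N HN] := mesh_bounded; exists N => x /interior_subset[e _ ex].
exact: HN ex.
Qed.

Lemma measurable_piece (k : V -> R) e : continuous k ->
  measurable_fun [set: mR * mR] ((fun x => \1_(elt e) x * k x) \o pt).
Proof.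
move=> ck; apply: measurable_funM; last exact: measurable_pt.
rewrite (_ : (fun x => _) = \1_(pt @^-1` elt e)); last first.
  by apply/funext => z; rewrite !indicE -mem_preimage_pt.
by apply: measurable_indic; exact: measurable_elt.
Qed.

Lemma measurable_pieces h : (forall e, continuous (h e)) ->
  measurable_fun [set: mR * mR] (pieces h \o pt).
Proof.
move=> ch; apply: (@measurable_sum _ _ _ _ _ _ (fun e z => \1_(elt e) (pt z) * h e (pt z))) => e.
exact: measurable_piece.
Qed.

Lemma bounded_pieces h : (forall e, continuous (h e)) ->
  exists C, forall x, `|pieces h x| <= C.
Proof.
move=> ch; have /choice[C HC] e := continuous_compact_bounded (@compact_elt e) (ch e).
exists (\sum_e `|C e|) => x; rewrite (le_trans (ler_norm_sum _ _ _))//.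
apply: ler_sum => e _; rewrite normrM indicE.
have [ex|ex] := boolP (x \in elt e); last by rewrite normr0 mul0r.
rewrite normr1 mul1r (le_trans _ (ler_norm _))//; apply: HC.
by apply: elt_sub_image; rewrite inE in ex.
Qed.

(** A bounded measurable function on a bounded set; the bounds come from the compactness of the
    finitely many elements. *)
Lemma L2_pieces h : (forall e, continuous (h e)) -> L2 A (pieces h).
Proof.
move=> ch; have mh := measurable_pieces ch; have [C HC] := bounded_pieces ch.
have [N HN] := domain_bounded.
rewrite /L2 inE; apply/andP; split; rewrite inE /=.
  by apply/(measurable_restrictT _ measurable_domain); exact: measurable_funTS.
rewrite /finite_norm unlock poweR_lty//.
have ik : (@leb2 R).-integrable (pt @^-1` A) (EFin \o ((fun x => `|pieces h x| `^ 2) \o pt)).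
  apply: (@bounded_integrable _ _ _ N (C ^+ 2)) => //.
  - exact: measurable_domain.
  - rewrite (_ : _ \o pt = (fun r : R => r `^ 2) \o ((@Num.norm R R) \o (pieces h \o pt)))//.
    by apply: measurableT_comp; [exact: measurable_powR|exact: measurableT_comp].
  - move=> x _; rewrite ger0_norm ?powR_ge0// powR_mulrn//.
    by rewrite ler_sqr ?nnegrE ?(le_trans _ (HC x)).
have := integrable_lty measurable_domain ik.
rewrite [X in (X < _)%E -> _]integral_mkcond; congr (_ < _)%E.
apply: eq_integral => z _; rewrite /= !patchE; case: ifPn => _ //=.
by rewrite normr0 powR0.
Qed.

Lemma integrable_piece (k : V -> R) e : continuous k ->
  (@leb2 R).-integrable (pt @^-1` A) (EFin \o ((fun x => \1_(elt e) x * k x) \o pt)).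
Proof.
move=> ck; have [C HC] := continuous_compact_bounded (@compact_elt e) ck.
have [N HN] := domain_bounded.
apply: (@bounded_integrable _ _ _ N `|C|) => //.
- exact: measurable_domain.
- exact: measurable_piece.
- move=> x _; rewrite normrM indicE.
  have [ex|ex] := boolP (x \in elt e); last by rewrite normr0 mul0r.
  rewrite normr1 mul1r (le_trans _ (ler_norm _))//; apply: HC.
  by apply: elt_sub_image; rewrite inE in ex.
Qed.

Lemma int2_pieces h : (forall e, continuous (h e)) ->
  int2 A (pieces h) = \sum_e int2 (elt e) (h e).
Proof.
move=> ch; rewrite /int2 /Rintegral.
have ih e := integrable_piece e (ch e).
pose q e : mR * mR -> \bar R := EFin \o ((fun x => \1_(elt e) x * h e x) \o pt).
transitivity (fine (\int[@leb2 R]_(z in pt @^-1` A) (\sum_(e : E) q e z))%E).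
  by congr fine; apply: eq_integral => z _; rewrite /= sumEFin.
have fq e : (\int[@leb2 R]_(z in pt @^-1` A) q e z)%E \is a fin_num.
  by apply: integrable_fin_num; [exact: measurable_domain|exact: ih].
rewrite integral_sum//; last exact: measurable_domain.
rewrite -sum_fine => [|e _]; last exact: fq.
apply: eq_bigr => e _; congr fine.
rewrite [LHS]integral_mkcond [RHS]integral_mkcond; apply: eq_integral => z _.
rewrite !patchE /q /= indicE.
rewrite !mem_preimage_pt.
case: (boolP (pt z \in elt e)) => ze; last by rewrite mul0r; case: ifP.
have -> : pt z \in A by rewrite inE; rewrite inE in ze; exact: elt_domain ze.
by rewrite mul1r.
Qed.

End Assembly.

(** * The distributional divergence of a piecewise Piola field *)

Section WeakDivergence.
Variables (R : realType) (E : finType) (M : E -> 'rV[R]_2 -> 'rV[R]_2).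
Hypothesis hM : conforming_mesh M.
Variables (B : E -> 'M[R]_2) (b : E -> 'rV[R]_2).
Hypothesis MB : forall e, M e = fun x => x *m B e + b e.
Variable phi : E -> 'rV[R]_2 -> 'rV[R]_2.
Hypothesis C1phi : forall e, C1_field (phi e).
Local Notation V := 'rV[R]_2.
Local Notation mR := (measurableTypeR R).
Local Notation mu := (@lebesgue_measure R).
Local Notation pt := (@pt R).
Local Notation elt := (elt M).
Local Notation Minv := (Minv B b).
Local Notation A := (domain M).

(** The Piola image written with the affine inverse: equal to [piola] on the element and continuous
    everywhere. *)
Definition piola_inv e (x : V) : V := (\det (B e))^-1 *: (phi e (Minv e x) *m B e).

(** The classical identity for the divergence of a Piola image, here used as the candidate for the
    weak divergence on each element. *)
Definition piola_div e (x : V) : R :=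
  (\det (B e))^-1 * \sum_i 'D_(delta_mx 0 i) (fun y => phi e y 0 i) (Minv e x).

Lemma piola_invE e x : elt e x -> piola M e (phi e) x = piola_inv e x.
Proof.
move=> /elt_sub_image ex.
by rewrite /piola (inv_mapE hM MB ex) (jacobian_affine MB).
Qed.

Lemma continuous_comp_Minv (f : V -> R) e : continuous f -> continuous (f \o Minv e).
Proof.
move=> cf x; apply: (@continuous_comp _ _ _ (Minv e) f); last exact: cf.
exact: Minv_continuous.
Qed.

Lemma piola_inv_continuous e i : continuous (fun x => piola_inv e x 0 i).
Proof.
have -> : (fun x => piola_inv e x 0 i) = (fun y : V => (\det (B e))^-1 *
    (\sum_j phi e y 0 j * B e j i)) \o Minv e.
  by apply/funext => x; rewrite /piola_inv !mxE.
apply: continuous_comp_Minv; apply: C1_continuous; apply: C1M; first exact: C1_cst.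
by apply: C1_sum => j; apply: C1M; [exact: C1phi|exact: C1_cst].
Qed.

Lemma piola_div_continuous e : continuous (piola_div e).
Proof.
apply: (@continuous_comp_Minv (fun y => (\det (B e))^-1 *
  \sum_i 'D_(delta_mx 0 i) (fun y => phi e y 0 i) y)).
apply: continuous_mul; first exact: cst_continuous.
have c i : continuous ('D_(delta_mx 0 i) (fun y => phi e y 0 i)).
  exact: (proj2 (C1phi e i)).
by under eq_fun do rewrite sum2E; apply: continuous_add; exact: c.
Qed.

Lemma piecewise_pieces u i : (forall e, u e = piola M e (phi e)) ->
  (fun x => piecewise M u x 0 i) = pieces M (fun e x => piola_inv e x 0 i).
Proof.
move=> uE; apply/funext => x; rewrite /piecewise summxE; apply: eq_bigr => e _.
rewrite mxE uE indicE; have [ex|ex] := boolP (x \in _); last by rewrite !mul0r.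
by rewrite piola_invE//; rewrite inE in ex.
Qed.

Lemma integrable_elt (k : V -> R) e : continuous k ->
  (@leb2 R).-integrable (pt @^-1` elt e) (EFin \o (k \o pt)).
Proof.
move=> ck; have [C HC] := continuous_compact_bounded (@compact_elt _ _ _ _ _ MB e) ck.
have [N HN] := mesh_bounded MB.
apply: (@bounded_integrable _ _ _ N C).
- exact: measurable_elt.
- exact: measurable_pt.
- by move=> x /elt_sub_image; exact: HN.
- by move=> x /elt_sub_image; exact: HC.
Qed.

Lemma int2D e (g h : V -> R) : continuous g -> continuous h ->
  int2 (elt e) (fun x => g x + h x) = int2 (elt e) g + int2 (elt e) h.
Proof.
move=> cg ch; rewrite /int2 RintegralD//.
- exact: measurable_elt.
- exact: integrable_elt.
- exact: integrable_elt.
Qed.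

(* The factor sg (det B) * edge_sign s turns the normal rot90 (tangent s) outwards. *)
Definition edge_flux (f : V -> R) e s : R := Num.sg (\det (B e)) * (edge_sign R s *
   \int[mu]_(t in `[0, 1]) (f (M e (edge_pt s t)) * normal_comp s (phi e (edge_pt s t)))).

Lemma piola_inv_grad_continuous (f : V -> R) e : Ck 1 f ->
  continuous (fun x => \sum_i piola_inv e x 0 i * 'D_(delta_mx 0 i) f x).
Proof.
move=> Cf; have cD i : continuous ('D_(delta_mx 0 i) f) by exact: (proj2 Cf).
under eq_fun do rewrite sum2E.
by apply: continuous_add; apply: continuous_mul => //; exact: piola_inv_continuous.
Qed.

Lemma piola_div_mul_continuous (f : V -> R) e : Ck 1 f ->
  continuous (fun x => piola_div e x * f x).
Proof.
by move=> Cf; apply: continuous_mul; [exact: piola_div_continuous|exact: C1_continuous].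
Qed.

Lemma element_divergence (f : V -> R) e : Ck 1 f ->
  int2 (elt e) (fun x => \sum_i piola_inv e x 0 i * 'D_(delta_mx 0 i) f x) +
  int2 (elt e) (fun x => piola_div e x * f x) = \sum_(s <- edges) edge_flux f e s.
Proof.
move=> Cf; have D0 := det_affine hM MB e.
have c1 := piola_inv_grad_continuous (e := e) Cf; have c2 := piola_div_mul_continuous (e := e) Cf.
rewrite -int2D//.
(* The reference field whose Piola image is [f] times the field on the element. By the product and
   chain rules, [key] is the Piola identity for it. *)
pose W y := f (M e y) *: phi e y.
have CW i : Ck 1 (fun y => W y 0 i).
  rewrite /W; under eq_fun do rewrite mxE.
  by apply: C1M; [rewrite MB; exact: C1_affine|exact: C1phi].
have key y : \sum_i piola_inv e (M e y) 0 i * 'D_(delta_mx 0 i) f (M e y) +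
    piola_div e (M e y) * f (M e y) =
    (\det (B e))^-1 * \sum_i 'D_(delta_mx 0 i) (fun y => W y 0 i) y.
  have dW i : 'D_(delta_mx 0 i) (fun y => W y 0 i) y =
      f (M e y) * 'D_(delta_mx 0 i) (fun y => phi e y 0 i) y +
      phi e y 0 i * \sum_j B e i j * 'D_(delta_mx 0 j) f (M e y).
    rewrite /W; under eq_fun do rewrite mxE.
    rewrite deriveM; last 2 first.
    - apply: diff_derivable; rewrite MB; exact: (proj1 (C1_affine (B e) (b e) Cf)).
    - apply: diff_derivable; exact: (proj1 (C1phi e i)).
    congr (_ + _ *: _).
    rewrite MB derive_affine -rowE (deriveE _ (proj1 Cf _)).
    rewrite [row i (B e)]row_sum_delta linear_sum.
    by apply: eq_bigr => j _; rewrite linearZ /= mxE -deriveE//; exact: (proj1 Cf).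
  rewrite !sum2E !dW /piola_inv /piola_div (MK hM MB) !mxE !sum2E.
  ring.
rewrite (int2_affine (b := b e) D0)//; last 3 first.
- exact: measurable_elt.
- by apply: measurable_pt; exact: continuous_add.
- rewrite -MB (preimage_elt hM MB); apply: continuous_integrable_open_Gamma => y.
  apply: (@continuous_comp _ _ _ (M e) (fun x => \sum_i piola_inv e x 0 i * 'D_(delta_mx 0 i) f x +
    piola_div e x * f x)); first exact: (M_continuous MB).
  by apply: continuous_add.
rewrite -MB (preimage_elt hM MB).
have cW : continuous (fun y => \sum_i 'D_(delta_mx 0 i) (fun y => W y 0 i) y).
  by under eq_fun do rewrite sum2E; apply: continuous_add; exact: (proj2 (CW _)).
transitivity (`|\det (B e)| * ((\det (B e))^-1 *
    int2 (@open_Gamma R) (fun y => \sum_i 'D_(delta_mx 0 i) (fun y => W y 0 i) y))).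
  congr (_ * _); rewrite /int2 -RintegralZl.
  - by apply: eq_Rintegral => z _; exact: key.
  - by apply: measurable_pt_open; exact: open_open_Gamma.
  - exact: (continuous_integrable_open_Gamma cW).
rewrite reference_divergence// mulrA.
(* The change of variables contributes the absolute value and the Piola transformation the signed
   inverse; only the sign survives. *)
have -> : `|\det (B e)| / \det (B e) = Num.sg (\det (B e)) by rewrite normrEsg mulfK.
rewrite mulr_sumr; apply: eq_bigr => s _; congr (_ * (_ * _)).
by apply: eq_Rintegral => t _; rewrite /W normal_compZ.
Qed.

Lemma edge_flux_opposite (f : V -> R) e s e' s' :
  (forall t, 0 <= t <= 1 -> normal_comp s (phi e (edge_pt s t)) =
    normal_comp s' (phi e' (edge_pt s' t))) ->
  interface M e s e' s' -> edge_flux f e s = - edge_flux f e' s'.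
Proof.
move=> tr es; rewrite /edge_flux !mulrA -mulNr; congr (_ * _).
  have := interface_opposite hM MB es.
  have sgE s0 (d : R) : Num.sg d * edge_sign R s0 = Num.sg (d * edge_sign R s0).
    by rewrite sgrM; case: s0; rewrite /edge_sign ?sgr1 ?sgrN1.
  rewrite !sgE; set x := _ * edge_sign R s; set y := _ * edge_sign R s'.
  have [x0|x0|->] := ltgtP x 0; have [y0|y0|->] := ltgtP y 0;
    rewrite ?mulr0 ?mul0r ?ltxx// => xy.
  - by exfalso; nra.
  - by rewrite (ltr0_sg x0) (gtr0_sg y0).
  - by rewrite (gtr0_sg x0) (ltr0_sg y0) opprK.
  - by exfalso; nra.
apply: eq_Rintegral => t; rewrite inE /= in_itv /= => t01.
by rewrite (interface_edge_pt hM es t01) tr.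
Qed.

Lemma edge_flux_boundary (f : V -> R) e s : continuous f -> (forall x, ~ A x -> f x = 0) ->
  (forall e' s', ~ interface M e s e' s') -> edge_flux f e s = 0.
Proof.
move=> cf f0 nes; rewrite /edge_flux.
have ck : continuous (fun t : R => f (M e (edge_pt s t)) * normal_comp s (phi e (edge_pt s t))).
  have cfM : continuous (f \o M e).
    move=> y; apply: (@continuous_comp _ _ _ (M e) f); last exact: cf.
    exact: (M_continuous MB).
  have cn : continuous (fun y => normal_comp s (phi e y)).
    apply: C1_continuous; under eq_fun do rewrite normal_compE.
    case: (s); [|exact: C1phi|by apply: C1D; exact: C1phi].
    by under eq_fun do rewrite -mulN1r; apply: C1M; [exact: C1_cst|exact: C1phi].
  exact: (@continuous_edge R (fun y => f (M e y) * normal_comp s (phi e y)) s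
     (continuous_mul cfM cn)).
(* The open interval leaves out the two vertices, to which [domain_edge_shared] does not apply. *)
rewrite /Rintegral -integral_oo_cc// integral0_eq ?mulr0// => t /=.
rewrite in_itv /= => t01; rewrite f0 ?mul0r// => At.
by have [e' [s' /nes]] := domain_edge_shared hM MB t01 At.
Qed.

Lemma test_function_C1 f : test_function A f -> Ck 1 f.
Proof. by case=> Cf _ _; exact: Cf. Qed.

Lemma test_function_out f x : test_function A f -> ~ A x -> f x = 0.
Proof.
move=> [_ _ sA] Ax; apply: contrapT => fx; apply: Ax; apply: sA.
by apply: subset_closure; apply/eqP.
Qed.

Lemma Hdiv_piecewise u : (forall e, u e = piola M e (phi e)) ->
  no_normal_jump M u -> Hdiv A (piecewise M u).
Proof.
move=> uE jump.
have trace e s e' s' t : interface M e s e' s' -> 0 <= t <= 1 ->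
    normal_comp s (phi e (edge_pt s t)) = normal_comp s' (phi e' (edge_pt s' t)).
  by move=> es t01; exact: (no_jump_trace hM jump (uE e) (uE e') es t01).
split=> [i|]; first by rewrite (piecewise_pieces i uE); apply: (L2_pieces MB) => e; exact: piola_inv_continuous.
exists (pieces M piola_div); first by apply: (L2_pieces MB); exact: piola_div_continuous.
move=> f ft; have Cf := test_function_C1 ft; have cf := C1_continuous Cf.
have -> : (fun x => \sum_(i < 2) piecewise M u x 0 i * 'D_(delta_mx 0 i) f x) =
    pieces M (fun e x => \sum_i piola_inv e x 0 i * 'D_(delta_mx 0 i) f x).
  apply/funext => x; rewrite sum2E.
  rewrite (congr1 (fun g : V -> R => g x) (piecewise_pieces 0 uE)).
  rewrite (congr1 (fun g : V -> R => g x) (piecewise_pieces 1 uE)).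
  rewrite /pieces !mulr_suml -big_split; apply: eq_bigr => e _ /=.
  by rewrite sum2E mulrDr !mulrA.
have -> : (fun x => pieces M piola_div x * f x) = pieces M (fun e x => piola_div e x * f x).
  by apply/funext => x; rewrite /pieces mulr_suml; apply: eq_bigr => e _; rewrite [RHS]mulrA.
rewrite !(int2_pieces MB); last 2 first.
- by move=> e; exact: piola_div_mul_continuous.
- by move=> e; exact: piola_inv_grad_continuous.
apply/eqP; rewrite -addr_eq0 -big_split /=; apply/eqP.
under eq_bigr do rewrite element_divergence// (big_nth E12) big_mkord.
rewrite pair_big /=.
(* Numbering the local edges makes the pairs of an element and one of its edges a finite type, over
   which fluxes are summed and paired. *)
pose ed (k : 'I_3) := nth E12 edges k.
have ed_inj : injective ed.
  by move=> [[|[|[|//]]] k3] [[|[|[|//]]] k3'] //= _; exact/val_inj.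
have ed_surj s : exists k, ed k = s.
  by case: s; [exists 0|exists (lift 0 0)|exists (lift 0 (lift 0 0))].
apply: (sum_antisymmetric_pairing (r := fun p q => interface M p.1 (ed p.2) q.1 (ed q.2))).
- by move=> p q; exact: interface_sym.
- move=> [e k] [e1 k1] [e2 k2] /= h1 h2; have [e12|e12] := eqVneq e1 e2.
    subst e2; congr pair; apply: ed_inj; apply: (image_edge_inj hM (e := e1)).
    by rewrite -(proj2 h1) (proj2 h2).
  (* Two different partners of one edge would also be partners of each other. The three pairwise
     products would be negative, although their product is the square of [x * y * z]. *)
  have h3 : interface M e1 (ed k1) e2 (ed k2).
    by split=> //; rewrite -(proj2 h1) (proj2 h2).
  have := interface_opposite hM MB h1; have := interface_opposite hM MB h2.
  have := interface_opposite hM MB h3.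
  set x := _ * edge_sign R (ed k1); set y := _ * edge_sign R (ed k2); set z := _ * edge_sign R (ed k).
  by move=> xy zy zx; exfalso; have := sqr_ge0 (x * y * z); nra.
- move=> [e k] [e' k'] /= es; apply: edge_flux_opposite => // t t01; exact: trace.
- move=> [e k] /= nes; apply: edge_flux_boundary => //.
    by move=> x; exact: test_function_out.
  by move=> e' s'; have [k' <-] := ed_surj s' => es; apply: (nes (e', k')).
Qed.

End WeakDivergence.

Theorem theorem3p4 (R : realType) (p : nat) (hp : (1 <= p)%N)
    (U : h1_basis R p) (hU : polynomial_basis U) (hconf : h1_conforming U) :
  hdiv_conforming U (hdiv_template R).
Proof.
move=> E M hM u us; have jump := hdiv_space_no_jump hU hconf hM us.
split=> // aM.
have [phi phiE] := hdiv_space_C1 us.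
have [Bb BbE] : {Bb : E -> 'M[R]_2 * 'rV[R]_2 & forall e, M e = fun x => x *m (Bb e).1 + (Bb e).2}.
  apply: (@choice _ _ (fun e Bb => M e = fun x => x *m Bb.1 + Bb.2)) => e.
  by have [B [b ME]] := aM e; exists (B, b); apply/funext.
apply: (Hdiv_piecewise hM BbE (phi := phi)) jump.
- by move=> e; exact: (proj1 (phiE e)).
- by move=> e; exact: (proj2 (phiE e)).
Qed.
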